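(* Let $R=\exp(t^{12})\in\hat{\mathcal A}_2$ and let $\Phi\in\hat{\mathcal A}_3$ satisfy $\Phi\cdot\Phi^{321}=1$, $\eta_1\Phi=\eta_2\Phi=\eta_3\Phi=1$, and $\Phi=\exp(\phi)$ for some $\phi\in\hat{\mathcal L}_3$. Consider the equations positive hexagon: $(\Delta 1)R=\Phi\cdot R^{23}\cdot(\Phi^{-1})^{132}\cdot R^{13}\cdot\Phi^{312}$ in $\hat{\mathcal A}_3$; negative hexagon: $(\Delta 1)(R^{-1})=\Phi\cdot (R^{-1})^{23}\cdot(\Phi^{-1})^{132}\cdot (R^{-1})^{13}\cdot\Phi^{312}$ in $\hat{\mathcal A}_3$; pentagon: $\Phi^{123}\cdot(1\Delta1)\Phi\cdot\Phi^{234}=(\Delta11)\Phi\cdot(11\Delta)\Phi$ in $\hat{\mathcal A}_4$. Both sides of each equation are group-like (exponentials of elements of $\hat{\mathcal L}_3$, resp. $\hat{\mathcal L}_4$). The hexagons and the pentagon hold modulo 1FF if and only if their logarithmic images (the equations in $\hat{\mathcal L}_3$, resp. $\hat{\mathcal L}_4$, obtained by applying $\log$ to both sides) hold modulo $[[\mathcal L,\mathcal L],[\mathcal L,\mathcal L]]$.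
   Context: All algebras are over $\mathbb Q$. For $n\ge 2$, $\mathcal A_n$ is the graded unital associative algebra (horizontal chord diagrams on $n$ strands) generated by degree-one elements $t^{ij}=t^{ji}$ ($1\le i\ne j\le n$) with relations $[t^{ij}+t^{jk},t^{ik}]=0$ for distinct $i,j,k$ and $[t^{ij},t^{kl}]=0$ for distinct $i,j,k,l$; $\hat{\mathcal A}_n$ is its degree completion. $\mathcal L_n$ is the Lie algebra with the same generators and relations (bracket $=$ commutator) and $\hat{\mathcal L}_n\subset\hat{\mathcal A}_n$ its completion. $[[\mathcal L,\mathcal L],[\mathcal L,\mathcal L]]$ is the (closed) Lie ideal of $\hat{\mathcal L}_n$ generated by commutators of commutators, where $\mathcal L=\mathcal L_n$ with $n=3$ for the hexagons and $n=4$ for the pentagon. 1FF is the (closed) two-sided ideal of $\hat{\mathcal A}_n$ generated by all $u(xy-yx)$ with $x,y\in\hat{\mathcal A}_n$ and $u$ of degree $\ge1$. $\eta_i:\hat{\mathcal A}_3\to\hat{\mathcal A}_2$ is the algebra map sending $t^{jk}$ to $0$ if $i\in\{j,k\}$, and otherwise deleting strand $i$ and relabeling. Strand-doubling algebra maps: $(\Delta1):\hat{\mathcal A}_2\to\hat{\mathcal A}_3$, $t^{12}\mapsto t^{13}+t^{23}$; and $\hat{\mathcal A}_3\to\hat{\mathcal A}_4$ given by $(\Delta11)$: $t^{12}\mapsto t^{13}+t^{23}$, $t^{13}\mapsto t^{14}+t^{24}$, $t^{23}\mapsto t^{34}$; $(1\Delta1)$: $t^{12}\mapsto t^{12}+t^{13}$,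 $t^{13}\mapsto t^{14}$, $t^{23}\mapsto t^{24}+t^{34}$; $(11\Delta)$: $t^{12}\mapsto t^{12}$, $t^{13}\mapsto t^{13}+t^{14}$, $t^{23}\mapsto t^{23}+t^{24}$. For a sequence $xy\ldots z$ of distinct strand labels, $D^{xy\ldots z}$ is the image of $D$ under the algebra map relabeling strands $1\mapsto x$, $2\mapsto y$, etc. (e.g. $R^{23}=\exp(t^{23})$; $\Phi^{312}$ is obtained by $t^{12}\mapsto t^{13}$, $t^{23}\mapsto t^{12}$, $t^{13}\mapsto t^{23}$; $\Phi^{234}$ by $t^{12}\mapsto t^{23}$, $t^{23}\mapsto t^{34}$, $t^{13}\mapsto t^{24}$). *)

(* Defs.v *)
From HB Require Import structures.
From mathcomp Require Import all_boot all_order all_algebra.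
From mathcomp Require Import generic_quotient ring_quotient.
From mathcomp Require Import boolp classical_sets functions.

Set Implicit Arguments.
Unset Strict Implicit.
Unset Printing Implicit Defensive.

Import GRing.Theory.
Local Open Scope ring_scope.
Local Open Scope classical_set_scope.
Local Open Scope quotient_scope.

Definition bracket (A : pzRingType) (x y : A) : A := x * y - y * x.

Definition subspace (V : lmodType rat) (I : set V) : Prop :=
  I 0 /\ forall (a : rat) x y, I x -> I y -> I (a *: x + y).

Definition two_sided_ideal (A : algType rat) (I : set A) : Prop :=
  subspace I /\ forall a x, I x -> I (a * x) /\ I (x * a).

Definition lie_subalgebra (A : algType rat) (I : set A) : Prop :=
  subspace I /\ forall x y, I x -> I y -> I (bracket x y).

Definition lie_ideal (A : algType rat) (L I : set A) : Prop :=
  [/\ I `<=` L, subspace I & forall l x, L l -> I x -> I (bracket l x)].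

(* Sequential closedness for the linear topology whose basic neighbourhoods
   of 0 are the members of the decreasing filtration F. *)
Definition fclosed (V : zmodType) (F : nat -> set V) (I : set V) : Prop :=
  forall x, (forall N, exists2 y, I y & F N (x - y)) -> I x.

(* Noncommutative formal power series: a series is the family of its
   coefficients on words, i.e. an element of the degree completion of the free
   associative algebra on G. The alias keeps the Cauchy product below apart
   from the pointwise product that function types already carry. *)
Definition ncseries (G : Type) : Type := seq G -> rat.

HB.instance Definition _ (G : Type) := Choice.copy (ncseries G) (seq G -> rat^o).
HB.instance Definition _ (G : Type) :=
  GRing.Lmodule.copy (ncseries G) (seq G -> rat^o).

Section SeriesRing.
Variable G : Type.
Implicit Types f g h : ncseries G.

Definition ncone : ncseries G := fun w => (nilp w)%:R.

Definition ncmul f g : ncseries G :=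
  fun w => \sum_(k < (size w).+1) f (take k w) * g (drop k w).

Definition ncvalge (N : nat) : set (ncseries G) :=
  [set f | forall w, (size w < N)%N -> f w = 0].

Definition ncshift (c : G) f : ncseries G := fun w => f (c :: w).

Lemma ncmul_nil f g : ncmul f g [::] = f [::] * g [::].
Proof. by rewrite /ncmul big_ord_recl big_ord0 addr0. Qed.

Lemma ncmul_cons f g c w :
  ncmul f g (c :: w) = f [::] * g (c :: w) + ncmul (ncshift c f) g w.
Proof. by rewrite /ncmul big_ord_recl /=. Qed.

Lemma ncmulDl : left_distributive ncmul +%R.
Proof.
move=> f g h; apply/funext => w.
rewrite /ncmul -[RHS]big_split /=; apply: eq_bigr => i _.
by rewrite -mulrDl.
Qed.

Lemma ncmulDr : right_distributive ncmul +%R.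
Proof.
move=> f g h; apply/funext => w.
rewrite /ncmul -[RHS]big_split /=; apply: eq_bigr => i _.
by rewrite -mulrDr.
Qed.

Lemma ncscalelA (a : rat) f g : a *: ncmul f g = ncmul (a *: f) g.
Proof.
apply/funext => w; rewrite /ncmul -[LHS]/(a * _) mulr_sumr.
by apply: eq_bigr => i _; rewrite mulrA.
Qed.

Lemma ncscalerA (a : rat) f g : a *: ncmul f g = ncmul f (a *: g).
Proof.
apply/funext => w; rewrite /ncmul -[LHS]/(a * _) mulr_sumr.
by apply: eq_bigr => i _; rewrite mulrCA.
Qed.

Lemma ncmulA : associative ncmul.
Proof.
move=> f g h; apply/funext => w; elim: w f => [|c w IHw] f.
  by rewrite !ncmul_nil mulrA.
rewrite !ncmul_cons ncmul_nil mulrDr mulrA -addrA IHw.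
have -> : ncshift c (ncmul f g) = f [::] *: ncshift c g + ncmul (ncshift c f) g.
  by apply/funext => v; rewrite /ncshift ncmul_cons.
by rewrite ncmulDl -ncscalelA.
Qed.

Lemma ncmul1l : left_id ncone ncmul.
Proof.
move=> f; apply/funext => -[|c w]; first by rewrite ncmul_nil mul1r.
rewrite ncmul_cons mul1r /ncmul big1 ?addr0 // => i _.
by rewrite /ncshift mul0r.
Qed.

Lemma ncmul1r : right_id ncone ncmul.
Proof.
move=> f; apply/funext => w; elim: w f => [|c w IHw] f.
  by rewrite ncmul_nil mulr1.
by rewrite ncmul_cons mulr0 add0r IHw.
Qed.

Lemma ncone_neq0 : ncone != 0.
Proof. by apply/eqP => /(congr1 (fun f : ncseries G => f [::])). Qed.

HB.instance Definition _ := GRing.Zmodule_isNzRing.Build (ncseries G)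
  ncmulA ncmul1l ncmul1r ncmulDl ncmulDr ncone_neq0.
HB.instance Definition _ :=
  GRing.Lmodule_isLalgebra.Build rat (ncseries G) ncscalelA.
HB.instance Definition _ :=
  GRing.Lalgebra_isAlgebra.Build rat (ncseries G) ncscalerA.

End SeriesRing.

(* Strands are labelled 1..n; the chord (i, j) with i < j stands for the
   generator t^{ij} = t^{ji}. *)
Definition chord (n : nat) : finType :=
  {p : 'I_n.+1 * 'I_n.+1 | (0 < p.1)%N && (p.1 < p.2)%N}.

Definition chord_ends n (c : chord n) : nat * nat :=
  (nat_of_ord (val c).1, nat_of_ord (val c).2).

(* The generator t^{ij}; zero when i = j or when i or j is not a strand. *)
Definition tser (n i j : nat) : ncseries (chord n) := fun w =>
  if w is [:: c]
  then ((chord_ends c == (i, j)) || (chord_ends c == (j, i)))%:R else 0.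

Arguments tser : clear implicits.

Definition strands (n : nat) (s : seq nat) : bool :=
  uniq s && all (fun i => (0 < i <= n)%N) s.

Definition relators (n : nat) : set (ncseries (chord n)) :=
  [set r | exists i j k, strands n [:: i; j; k] /\
     r = bracket (tser n i j + tser n j k) (tser n i k)] `|`
  [set r | exists i j k l, strands n [:: i; j; k; l] /\
     r = bracket (tser n i j) (tser n k l)].

Arguments relators : clear implicits.

Definition closed_ideal_series (G : Type) (I : set (ncseries G)) : Prop :=
  two_sided_ideal I /\ fclosed (@ncvalge G) I.

Definition relset (n : nat) : set (ncseries (chord n)) :=
  smallest (@closed_ideal_series (chord n)) (relators n).

Arguments relset : clear implicits.

Section RelationIdeal.
Variable n : nat.
Local Notation S := (ncseries (chord n)).
Implicit Types f g : S.

Definition relideal : pred S := fun f => `[< relset n f >].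

Lemma relset_ideal : two_sided_ideal (relset n).
Proof.
split; first split.
- by move=> I [[[[I0 _] _] _] _].
- move=> a x y hx hy I hI; have [[[[_ hlin] _] _] _] := hI.
  exact: hlin (hx I hI) (hy I hI).
- move=> a x hx; split=> I hI; have [[[_ hm] _] _] := hI.
  + by have [] := hm a x (hx I hI).
  + by have [] := hm a x (hx I hI).
Qed.

Lemma relset_constant f : relset n f -> f [::] = 0.
Proof.
move=> /(_ [set g | g [::] = 0]); apply.
split; last first.
  by move=> _ [[i [j [k [_ ->]]]]|[i [j [k [l [_ ->]]]]]];
    rewrite /= /bracket -[LHS]/(ncmul _ _ _ - ncmul _ _ _) !ncmul_nil mulrC subrr.
split; last by move=> x /(_ 1%N)[y /= hy /(_ [::] isT)]; move=> /eqP;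
  rewrite subr_eq0 hy => /eqP.
split; first split=> //.
- by move=> a x y /= hx hy; rewrite -[LHS]/(a * _ + _) hx hy mulr0 addr0.
- by move=> a x /= hx; rewrite -[_ * _]/(ncmul _ _) -[x * a]/(ncmul _ _)
    !ncmul_nil hx mulr0 mul0r.
Qed.

Lemma relideal_zmod : zmod_closed relideal.
Proof.
have [[h0 hlin] _] := relset_ideal; split; first exact/asboolP.
move=> x y /asboolP hx /asboolP hy; apply/asboolP.
by rewrite addrC -scaleN1r; apply: hlin.
Qed.

HB.instance Definition _ := GRing.isZmodClosed.Build S relideal relideal_zmod.

Definition relzmod : zmodClosed S := GRing.ZmodClosed.clone S relideal _.

End RelationIdeal.

(* The degree completion of A_n: the relators are homogeneous, so it is the
   quotient of the series in the chords by the closed ideal they generate. *)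
Definition Ahat (n : nat) : Type := Quotient.quot (relzmod n).

HB.instance Definition _ n := GRing.Zmodule.on (Ahat n).

Definition Api (n : nat) (f : ncseries (chord n)) : Ahat n :=
  \pi_(Quotient.quot (relzmod n)) f.

Definition Arep (n : nat) (x : Ahat n) : ncseries (chord n) :=
  repr (x : Quotient.quot (relzmod n)).

Section QuotientAlgebra.
Variable n : nat.
Local Notation S := (ncseries (chord n)).
Local Notation A := (Ahat n).
Local Notation pi := (@Api n).
Implicit Types (f g : S) (x y z : A).

Lemma ArepK : cancel (@Arep n) pi.
Proof. by move=> x; rewrite /Api /Arep reprK. Qed.

Lemma Api_eq f g : (pi f = pi g) <-> relset n (f - g).
Proof.
split=> [|h].
  by move/eqP; rewrite /Api -Quotient.idealrBE => /asboolP.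
by apply/eqP; rewrite /Api -Quotient.idealrBE; apply/asboolP.
Qed.

Lemma ApiD f g : pi (f + g) = pi f + pi g.
Proof. by rewrite /Api !piE. Qed.

Lemma ApiN f : pi (- f) = - pi f.
Proof. by rewrite /Api !piE. Qed.

Lemma Arep_pi f : relset n (Arep (pi f) - f).
Proof. by apply/Api_eq; rewrite ArepK. Qed.

Definition Aone : A := pi 1.
Definition Amul x y : A := pi (Arep x * Arep y).
Definition Ascale (a : rat) x : A := pi (a *: Arep x).

Lemma ApiM f g : pi (f * g) = Amul (pi f) (pi g).
Proof.
have [[h0 hlin] hm] := @relset_ideal n.
apply/esym/Api_eq; set f' := Arep _; set g' := Arep _.
have -> : f' * g' - f * g = 1 *: ((f' - f) * g') + f * (g' - g).
  by rewrite scale1r mulrBl mulrBr addrA subrK.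
apply: hlin; first by case: (hm g' _ (Arep_pi f)).
by case: (hm f _ (Arep_pi g)).
Qed.

Lemma ApiZ a f : pi (a *: f) = Ascale a (pi f).
Proof.
have [[h0 hlin] hm] := @relset_ideal n.
apply/esym/Api_eq; rewrite -scalerBr -[X in relset n X]addr0.
exact: hlin (Arep_pi f) h0.
Qed.

Lemma Amul_assoc : associative Amul.
Proof.
by move=> x y z; rewrite -(ArepK x) -(ArepK y) -(ArepK z) -!ApiM mulrA.
Qed.

Lemma Amul_1l : left_id Aone Amul.
Proof. by move=> x; rewrite -(ArepK x) -ApiM mul1r. Qed.

Lemma Amul_1r : right_id Aone Amul.
Proof. by move=> x; rewrite -(ArepK x) -ApiM mulr1. Qed.

Lemma Amul_Dl : left_distributive Amul +%R.
Proof.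
move=> x y z; rewrite -(ArepK x) -(ArepK y) -(ArepK z).
by rewrite -ApiD -!ApiM -ApiD mulrDl.
Qed.

Lemma Amul_Dr : right_distributive Amul +%R.
Proof.
move=> x y z; rewrite -(ArepK x) -(ArepK y) -(ArepK z).
by rewrite -ApiD -!ApiM -ApiD mulrDr.
Qed.

Lemma Aone_neq0 : Aone != 0.
Proof.
apply/eqP; have -> : 0 = pi 0 by rewrite -(subrr (1 : S)) ApiD ApiN subrr.
by move/Api_eq/relset_constant; rewrite subr0.
Qed.

HB.instance Definition _ := GRing.Zmodule_isNzRing.Build A
  Amul_assoc Amul_1l Amul_1r Amul_Dl Amul_Dr Aone_neq0.

Lemma Ascale_A a b x : Ascale a (Ascale b x) = Ascale (a * b) x.
Proof. by rewrite -(ArepK x) -!ApiZ scalerA. Qed.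

Lemma Ascale_1 : left_id 1 Ascale.
Proof. by move=> x; rewrite -(ArepK x) -ApiZ scale1r. Qed.

Lemma Ascale_Dr : right_distributive Ascale +%R.
Proof.
by move=> a x y; rewrite -(ArepK x) -(ArepK y) -ApiD -!ApiZ -ApiD scalerDr.
Qed.

Lemma Ascale_Dl x : {morph Ascale^~ x : a b / a + b}.
Proof. by move=> a b; rewrite -(ArepK x) -!ApiZ -ApiD scalerDl. Qed.

HB.instance Definition _ := GRing.Zmodule_isLmodule.Build rat A
  Ascale_A Ascale_1 Ascale_Dr Ascale_Dl.

Lemma Ascale_mull (a : rat) x y : a *: (x * y) = a *: x * y.
Proof.
rewrite -(ArepK x) -(ArepK y) -[_ * _]/(Amul _ _) -[RHS]/(Amul (Ascale _ _) _).
by rewrite -[LHS]/(Ascale _ _) -ApiZ -!ApiM -ApiZ scalerAl.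
Qed.

Lemma Ascale_mulr (a : rat) x y : a *: (x * y) = x * (a *: y).
Proof.
rewrite -(ArepK x) -(ArepK y) -[_ * _]/(Amul _ _) -[RHS]/(Amul _ (Ascale _ _)).
by rewrite -[LHS]/(Ascale _ _) -ApiZ -!ApiM -ApiZ scalerAr.
Qed.

HB.instance Definition _ := GRing.Lmodule_isLalgebra.Build rat A Ascale_mull.
HB.instance Definition _ := GRing.Lalgebra_isAlgebra.Build rat A Ascale_mulr.

Definition Aunit : pred A := fun x => `[< exists y, y * x = 1 /\ x * y = 1 >].
Definition Ainv x : A := xget x [set y | y * x = 1 /\ x * y = 1].

Lemma AmulVr : {in Aunit, left_inverse 1 Ainv *%R}.
Proof.
move=> x /asboolP [y hy].
by have [] := @xgetPex _ x [set y | y * x = 1 /\ x * y = 1] (ex_intro _ y hy).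
Qed.

Lemma AmulrV : {in Aunit, right_inverse 1 Ainv *%R}.
Proof.
move=> x /asboolP [y hy].
by have [] := @xgetPex _ x [set y | y * x = 1 /\ x * y = 1] (ex_intro _ y hy).
Qed.

Lemma AunitP x y : y * x = 1 /\ x * y = 1 -> Aunit x.
Proof. by move=> h; apply/asboolP; exists y. Qed.

Lemma Ainv_out : {in [predC Aunit], Ainv =1 id}.
Proof.
move=> x /negP hx; apply: xgetPN => y hy.
by apply: hx; exact: AunitP hy.
Qed.

HB.instance Definition _ := GRing.NzRing_hasMulInverse.Build A
  AmulVr AmulrV AunitP Ainv_out.

End QuotientAlgebra.

Section CompletedAlgebra.
Variable n : nat.
Implicit Types x y : Ahat n.

Definition t (i j : nat) : Ahat n := Api (tser n i j).

Definition deg_ge (N : nat) : set (Ahat n) :=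
  [set x | exists2 f, ncvalge N f & x = Api f].

(* The sum of c k * x ^ k, for x without constant term: powers of x with
   exponent larger than the degree do not contribute. *)
Definition power_sum (c : nat -> rat) (x : Ahat n) : Ahat n :=
  Api (fun w => \sum_(k < (size w).+1) c k * (Arep x ^+ k) w).

Definition expA (x : Ahat n) : Ahat n := power_sum (fun k => (k`!)%:R^-1) x.

(* For x with constant term 1; the coefficient at k = 0 is 0 since 0^-1 = 0. *)
Definition logA (x : Ahat n) : Ahat n :=
  power_sum (fun k => (-1) ^+ k.+1 / k%:R) (x - 1).

(* A_n is the enveloping algebra of L_n, so L_n is the Lie subalgebra of A_n
   generated by the chords, and its degree completion the closed one. *)
Definition Lhat : set (Ahat n) :=
  smallest (fun I => lie_subalgebra I /\ fclosed deg_ge I)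
           [set x | exists i j, strands n [:: i; j] /\ x = t i j].

Definition LLLL : set (Ahat n) :=
  smallest (fun I => lie_ideal Lhat I /\ fclosed deg_ge I)
           [set x | exists a b c d, [/\ Lhat a, Lhat b, Lhat c & Lhat d] /\
              x = bracket (bracket a b) (bracket c d)].

Definition oneFF : set (Ahat n) :=
  smallest (fun I => two_sided_ideal I /\ fclosed deg_ge I)
           [set z | exists u x y, deg_ge 1 u /\ z = u * (x * y - y * x)].

Definition eqmod (I : set (Ahat n)) x y : Prop := I (x - y).

Definition grouplike (x : Ahat n) : Prop := exists2 a, Lhat a & x = expA a.

End CompletedAlgebra.

Arguments t {n} i j.

(* Substitution for the generators of series without constant term: longer
   words v than w do not contribute to the coefficient of w. *)
Definition ncsubst (G : finType) (H : Type) (F : G -> ncseries H)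
    (f : ncseries G) : ncseries H := fun w =>
  \sum_(k < (size w).+1) \sum_(v : k.-tuple G) f v * (\prod_(c <- v) F c) w.

(* The continuous algebra map sending t i j to F i j for i < j; meaningful
   when the F i j lie in degree at least 1 and satisfy the relations. *)
Definition alg_map (n m : nat) (F : nat -> nat -> Ahat m) (x : Ahat n) :
    Ahat m :=
  Api (ncsubst (fun c : chord n =>
         Arep (F (chord_ends c).1 (chord_ends c).2)) (Arep x)).

(* D^{xy...z} for s = [:: x; y; ...; z]. *)
Definition relabel (n m : nat) (s : seq nat) : Ahat n -> Ahat m :=
  alg_map (fun i j => t (nth 0%N s i.-1) (nth 0%N s j.-1)).

(* unbump i j is j.-1 if j > i and j otherwise. *)
Definition eta (i : nat) : Ahat 3 -> Ahat 2 :=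
  alg_map (fun j k =>
    if (i == j) || (i == k) then 0 else t (unbump i j) (unbump i k)).

Definition on3 (m : nat) (t12 t13 t23 : Ahat m) (i j : nat) : Ahat m :=
  if (i, j) == (1, 2)%N then t12 else
  if (i, j) == (1, 3)%N then t13 else t23.

Definition D1 : Ahat 2 -> Ahat 3 := alg_map (fun _ _ => t 1 3 + t 2 3).
Definition D11 : Ahat 3 -> Ahat 4 :=
  alg_map (on3 (t 1 3 + t 2 3) (t 1 4 + t 2 4) (t 3 4)).
Definition oneD1 : Ahat 3 -> Ahat 4 :=
  alg_map (on3 (t 1 2 + t 1 3) (t 1 4) (t 2 4 + t 3 4)).
Definition oneoneD : Ahat 3 -> Ahat 4 :=
  alg_map (on3 (t 1 2) (t 1 3 + t 1 4) (t 2 3 + t 2 4)).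

(* The positive hexagon is the case R = exp t^{12}, the negative one the case
   R = (exp t^{12})^-1. *)
Definition hexagon_lhs (R : Ahat 2) : Ahat 3 := D1 R.
Definition hexagon_rhs (Phi : Ahat 3) (R : Ahat 2) : Ahat 3 :=
  Phi * relabel 3 [:: 2; 3] R * relabel 3 [:: 1; 3; 2] Phi^-1
      * relabel 3 [:: 1; 3] R * relabel 3 [:: 3; 1; 2] Phi.

Definition pentagon_lhs (Phi : Ahat 3) : Ahat 4 :=
  relabel 4 [:: 1; 2; 3] Phi * oneD1 Phi * relabel 4 [:: 2; 3; 4] Phi.
Definition pentagon_rhs (Phi : Ahat 3) : Ahat 4 := D11 Phi * oneoneD Phi.

(* Main.v *)
(* Only the group-likeness of Phi matters.

   Group-like elements form a group. Let D be the derivation multiplying the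
   degree d part by d. Then exp(-c) D(exp c) = sum_k z_k / (k+1)! with z_0 = D c
   and z_(k+1) = [z_k, c], so this is a Lie element if c is, and conversely, by
   induction on the degree, only if c is. As (gh)^-1 D(gh) is
   h^-1 (g^-1 D g) h + h^-1 D h, products of group-like elements are group-like.
   So each equation has the form exp a = exp b with a and b in L, and since exp
   and log are limits of polynomials it holds modulo the closed ideal 1FF if and
   only if a - b is in 1FF.

   It remains to see that an element of L in 1FF is in L'' = [[L, L], [L, L]].
   The linear map which fixes generators and sends a word c_1 ... c_n, n >= 2, to
     1/n sum_(j >= 2) [..[[c_1, c_j], c_2], .., c_n]   (the second c_j omitted)
   depends modulo L'' only on c_1 and on the multiset of the other letters;
   therefore it kills 1FF. It also kills the defining relations of the algebra,
   and it is the identity modulo L'' on L. *)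

From HB Require Import structures.
From mathcomp Require Import all_boot all_order all_algebra.
From mathcomp Require Import ring.
From mathcomp Require Import boolp classical_sets functions.
Require Import Defs.

Set Implicit Arguments.
Unset Strict Implicit.
Unset Printing Implicit Defensive.

Import GRing.Theory.
Local Open Scope ring_scope.
Local Open Scope classical_set_scope.

(** * Subspaces, brackets and noncommutative series *)

(** The factor 1/n: exchanging the first two letters of c_1 c_2 w changes the sum of brackets,
    modulo L'', by n times [c_1, c_2] acted on by w. Two copies come from the terms where c_1 and
    c_2 meet, and one, by Jacobi, from each of the n - 2 other letters. So (c_1 c_2 - c_2 c_1) w
    goes to [c_1, c_2] acted on by w. The defining relators are brackets of degree-one elements: at
    the start of a word a relator becomes its own value in the algebra, which is 0, and behind a
    letter it dies by symmetry in the later letters. The same formula turns right multiplication of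
    an element of [L, L] by a Lie element e into the bracket with e, which gives the identity on
    [L, L].

    What shapes the proof is that the map lives on words. It reaches the quotient only through
    chosen representatives, so there it is linear only modulo an error. Hence every statement about
    it is a congruence modulo L'' plus degree N, with finite sums, and closedness of L'' removes N
    at the very end. *)

Section Subspace.
Variables (V : lmodType rat) (I : set V).
Hypothesis sI : subspace I.

Lemma subspace0 : I 0. Proof. by case: sI. Qed.

Lemma subspaceD x y : I x -> I y -> I (x + y).
Proof. by case: sI => _ h hx hy; rewrite -[x]scale1r; exact: h. Qed.

Lemma subspaceZ a x : I x -> I (a *: x).
Proof. by case: sI => h0 h hx; rewrite -[_ *: _]addr0; exact: h. Qed.

Lemma subspaceN x : I x -> I (- x).
Proof. by rewrite -scaleN1r; exact: subspaceZ. Qed.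

Lemma subspaceB x y : I x -> I y -> I (x - y).
Proof. by move=> hx /subspaceN; exact: subspaceD. Qed.

Lemma subspace_sum (J : Type) (r : seq J) (P : pred J) (F : J -> V) :
  (forall j, P j -> I (F j)) -> I (\sum_(j <- r | P j) F j).
Proof.
by move=> h; elim/big_rec: _ => [|j x /h hj hx];
  [exact: subspace0 | exact: subspaceD].
Qed.

Lemma subspaceBC x y : I (x - y) -> I (y - x).
Proof. by move=> /subspaceN; rewrite opprB. Qed.

Lemma subspaceBt y x z : I (x - y) -> I (y - z) -> I (x - z).
Proof. by move=> h1 h2; rewrite -(subrK y x) -addrA; exact: subspaceD. Qed.

Lemma subspaceBD x y x' y' : I (x - x') -> I (y - y') -> I (x + y - (x' + y')).
Proof. by move=> h1 h2; rewrite opprD addrACA; exact: subspaceD. Qed.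

Lemma subspaceBB x y x' y' : I (x - x') -> I (y - y') -> I (x - y - (x' - y')).
Proof. by move=> h1 /subspaceN h2; apply: subspaceBD; rewrite // -opprD. Qed.

Lemma subspaceBZ a x y : I (x - y) -> I (a *: x - a *: y).
Proof. by rewrite -scalerBr; exact: subspaceZ. Qed.

Lemma subspaceB_sum (J : Type) (r : seq J) (P : pred J) (F E : J -> V) :
  (forall j, P j -> I (F j - E j)) ->
  I (\sum_(j <- r | P j) F j - \sum_(j <- r | P j) E j).
Proof. by move=> h; rewrite -sumrB; exact: subspace_sum. Qed.

Lemma subspaceB_in x y : I (x - y) -> I y -> I x.
Proof. by move=> h1 h2; rewrite -(subrK y x); exact: subspaceD. Qed.

End Subspace.

Section Bracket.
Variable A : algType rat.
Implicit Types x y z : A.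

Lemma bracketDl x y z : bracket (x + y) z = bracket x z + bracket y z.
Proof. by rewrite /bracket mulrDl mulrDr opprD addrACA. Qed.

Lemma bracketDr x y z : bracket z (x + y) = bracket z x + bracket z y.
Proof. by rewrite /bracket mulrDl mulrDr opprD addrACA. Qed.

Lemma bracketC x y : bracket y x = - bracket x y.
Proof. by rewrite /bracket opprB. Qed.

Lemma bracketNl x y : bracket (- x) y = - bracket x y.
Proof. by rewrite /bracket mulNr mulrN opprB opprK addrC. Qed.

Lemma bracketNr x y : bracket x (- y) = - bracket x y.
Proof. by rewrite bracketC bracketNl -bracketC. Qed.

Lemma bracketBl x y z : bracket (x - y) z = bracket x z - bracket y z.
Proof. by rewrite bracketDl bracketNl. Qed.

Lemma bracketBr x y z : bracket z (x - y) = bracket z x - bracket z y.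
Proof. by rewrite bracketDr bracketNr. Qed.

Lemma bracketZl a x y : bracket (a *: x) y = a *: bracket x y.
Proof. by rewrite /bracket -scalerAl -scalerAr -scalerBr. Qed.

Lemma bracketZr a x y : bracket x (a *: y) = a *: bracket x y.
Proof. by rewrite /bracket -scalerAl -scalerAr -scalerBr. Qed.

Lemma bracket0l x : bracket 0 x = 0.
Proof. by rewrite /bracket mul0r mulr0 subrr. Qed.

Lemma bracket_suml (J : Type) (r : seq J) (P : pred J) (F : J -> A) x :
  bracket (\sum_(j <- r | P j) F j) x = \sum_(j <- r | P j) bracket (F j) x.
Proof. by rewrite /bracket mulr_suml mulr_sumr sumrB. Qed.

Lemma bracket_sumr (J : Type) (r : seq J) (P : pred J) (F : J -> A) x :
  bracket x (\sum_(j <- r | P j) F j) = \sum_(j <- r | P j) bracket x (F j).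
Proof. by rewrite /bracket mulr_suml mulr_sumr sumrB. Qed.

Lemma bracket_jacobi x y z :
  bracket (bracket x y) z = bracket (bracket x z) y + bracket x (bracket y z).
Proof.
rewrite /bracket !mulrBl !mulrBr !mulrA.
set a := x * y * z; set b := y * x * z; set c := z * x * y.
set d := z * y * x; set e := x * z * y; set f := y * z * x.
rewrite !opprB addrACA [RHS]addrACA [e - c + _]addrC [f - b + _]addrC !subrKA.
by rewrite [RHS]addrACA [- c - b]addrC.
Qed.

End Bracket.

Section Series.
Variable G : Type.
Implicit Types f g : ncseries G.

Lemma ncserM f g w : (f * g) w = \sum_(k < (size w).+1) f (take k w) * g (drop k w).
Proof. by []. Qed.

Lemma ncserD f g w : (f + g) w = f w + g w.
Proof. by []. Qed.

Lemma ncserZ a f w : (a *: f) w = a * f w.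
Proof. by []. Qed.

Lemma ncser_sum (J : Type) (r : seq J) (P : pred J) (F : J -> ncseries G) w :
  (\sum_(j <- r | P j) F j) w = \sum_(j <- r | P j) F j w.
Proof.
elim: r => [|j r IH]; first by rewrite !big_nil.
by rewrite !big_cons; case: (P j) => //; rewrite -IH.
Qed.

Lemma subspace_ncvalge N : subspace (@ncvalge G N).
Proof.
by split=> // a f g hf hg w lw; rewrite ncserD ncserZ hf // hg // mulr0 addr0.
Qed.

Lemma ncvalge_le M N : (M <= N)%N -> @ncvalge G N `<=` @ncvalge G M.
Proof. by move=> h f hf w lw; apply: hf; exact: leq_trans lw h. Qed.

Lemma ncvalgeM M N f g :
  ncvalge M f -> ncvalge N g -> ncvalge (M + N) (f * g).
Proof.
move=> hf hg w lw; rewrite ncserM big1 // => -[k /= hk] _.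
have [kM|Mk] := ltnP k M.
  by rewrite hf ?mul0r // size_takel // -ltnS.
rewrite hg ?mulr0 // size_drop.
have kw : (k <= size w)%N by [].
by rewrite ltn_subLR //; apply: (leq_trans lw); rewrite leq_add2r.
Qed.

Lemma ncvalge0 f : ncvalge 0 f.
Proof. by []. Qed.

Lemma ncvalgeMl N f g : ncvalge N f -> ncvalge N (g * f).
Proof. by move=> h; rewrite -[N]add0n; apply: ncvalgeM => //; exact: ncvalge0. Qed.

Lemma ncvalgeMr N f g : ncvalge N f -> ncvalge N (f * g).
Proof. by move=> h; rewrite -[N]addn0; apply: ncvalgeM => //; exact: ncvalge0. Qed.

Lemma ncvalge1P f : ncvalge 1 f <-> f [::] = 0.
Proof. by split=> [->//|h [|c w]]. Qed.

Lemma ncvalgeX f k : f [::] = 0 -> ncvalge k (f ^+ k).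
Proof.
move=> /ncvalge1P hf; elim: k => // k IH.
by rewrite exprS -add1n; exact: ncvalgeM.
Qed.

End Series.

Section Words.
Variable G : finType.
Implicit Types (f g : ncseries G) (u v w : seq G).

Definition ncword v : ncseries G := fun w => (w == v)%:R.

Lemma ncword_nil : ncword [::] = 1.
Proof. by apply/funext => -[|c w]. Qed.

Lemma ncwordM u v : ncword u * ncword v = ncword (u ++ v).
Proof.
apply/funext => w; rewrite ncserM /ncword.
have [lu|lu] := ltnP (size w) (size u).
  rewrite big1 => [|k _].
    have [e|//] := eqVneq w (u ++ v).
    by move: lu; rewrite e size_cat ltnNge leq_addr.
  rewrite (negPf (_ : take k w != u)) ?mul0r //; apply: contraTneq lu => <-.
  by rewrite -leqNgt size_take_min geq_minr.
rewrite (bigD1 (Ordinal (lu : (size u < (size w).+1)%N))) //= big1 ?addr0.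
  by rewrite -[in RHS](cat_take_drop (size u) w) eqseq_cat ?size_takel //
             -natrM mulnb.
move=> k /eqP hk; rewrite (negPf (_ : take k w != u)) ?mul0r //.
apply: contra_not_neq hk => tw; apply/val_inj => /=.
by rewrite -tw size_takel // -ltnS.
Qed.

Lemma ncvalge_word v : ncvalge (size v) (ncword v).
Proof. by move=> w; rewrite /ncword; have [->|//] := eqVneq w v; rewrite ltnn. Qed.

Lemma ncword_expand N f : ncvalge N
  (f - \sum_(k < N) \sum_(v : k.-tuple G) f v *: ncword v).
Proof.
move=> w lw; rewrite ncserD -[(- _) w]/(- (_ w)) ncser_sum.
rewrite (bigD1 (Ordinal lw)) //= ncser_sum (bigD1 (in_tuple w)) //=.
rewrite big1 ?addr0 => [|v nv]; last first.
  rewrite ncserZ /ncword (negPf (_ : w != v)) ?mulr0 //.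
  by apply: contraNneq nv => wv; apply/eqP/val_inj.
rewrite big1 ?addr0 => [|k nk]; first by rewrite ncserZ /ncword eqxx mulr1 subrr.
rewrite ncser_sum big1 // => v _.
rewrite ncserZ /ncword (negPf (_ : w != v)) ?mulr0 //.
by apply: contraNneq nk => wv; apply/eqP/val_inj; rewrite /= wv size_tuple.
Qed.

(** A linear condition that holds in high degree needs checking on words only. Restricting to words
    in the support of [f] later excludes empty prefixes and reduces linear series to single
    letters. *)
Lemma ncword_span N (P : set (ncseries G)) f :
  subspace P -> @ncvalge G N `<=` P -> (forall v, f v != 0 -> P (ncword v)) -> P f.
Proof.
move=> sP hN hP; apply: (subspaceB_in sP); first exact/hN/ncword_expand.
apply: (subspace_sum sP) => k _; apply: (subspace_sum sP) => v _.
have [->|nz] := eqVneq (f v) 0; first by rewrite scale0r; exact: subspace0.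
exact: subspaceZ (hP _ nz).
Qed.

End Words.

Lemma Api_is_zmod_morphism n : zmod_morphism (@Api n).
Proof. by move=> f g; rewrite ApiD ApiN. Qed.
HB.instance Definition _ n :=
  GRing.isZmodMorphism.Build (ncseries (chord n)) (Ahat n) (@Api n)
    (@Api_is_zmod_morphism n).
Lemma Api_is_monoid_morphism n : monoid_morphism (@Api n).
Proof. by split=> // f g; rewrite ApiM. Qed.
HB.instance Definition _ n :=
  GRing.isMonoidMorphism.Build (ncseries (chord n)) (Ahat n) (@Api n)
    (@Api_is_monoid_morphism n).
HB.instance Definition _ n :=
  GRing.isScalable.Build rat (ncseries (chord n)) (Ahat n) *:%R (@Api n)
    (@ApiZ n).

Lemma Api_bracket n (f g : ncseries (chord n)) :
  Api (bracket f g) = bracket (Api f) (Api g).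
Proof. by rewrite /bracket raddfB /= !rmorphM. Qed.

(** * The degree filtration on the completed algebra *)

Section Filtration.
Variable n : nat.
Implicit Types (f g : ncseries (chord n)) (x y z : Ahat n).

Lemma deg_ge_Api N f : ncvalge N f -> deg_ge N (Api f).
Proof. by exists f. Qed.

Lemma subspace_deg_ge N : subspace (@deg_ge n N).
Proof.
split; first by exists 0; rewrite ?raddf0.
move=> a _ _ [f hf ->] [g hg ->]; exists (a *: f + g); rewrite ?linearP //.
exact: (subspace_ncvalge _ N).2.
Qed.

Lemma deg_ge0 x : deg_ge 0 x.
Proof. by exists (Arep x); rewrite ?ArepK. Qed.

Lemma deg_ge_le M N x : (M <= N)%N -> deg_ge N x -> deg_ge M x.
Proof. by move=> h [f hf ->]; exists f => //; exact: ncvalge_le hf. Qed.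

Lemma deg_geM M N x y : deg_ge M x -> deg_ge N y -> deg_ge (M + N) (x * y).
Proof.
move=> [f hf ->] [g hg ->]; exists (f * g); rewrite ?rmorphM //.
exact: ncvalgeM.
Qed.

Lemma deg_geMl N x y : deg_ge N x -> deg_ge N (y * x).
Proof. by rewrite -[N]add0n; apply: deg_geM; exact: deg_ge0. Qed.

Lemma deg_geMr N x y : deg_ge N x -> deg_ge N (x * y).
Proof. by move=> h; rewrite -[N]addn0; apply: deg_geM => //; exact: deg_ge0. Qed.

Lemma deg_geX x k : deg_ge 1 x -> deg_ge k (x ^+ k).
Proof.
move=> hx; elim: k => [|k IH]; first exact: deg_ge0.
by rewrite exprS -add1n; exact: deg_geM.
Qed.

Lemma deg_ge_bracket M N x y :
  deg_ge M x -> deg_ge N y -> deg_ge (M + N) (bracket x y).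
Proof.
move=> hx hy; apply: (subspaceB (subspace_deg_ge _)); first exact: deg_geM.
by rewrite addnC; exact: deg_geM.
Qed.

(** The filtration is separated because [relset] is closed: a representative of [x] is approximated
    up to every degree by elements of [relset]. *)
Lemma Ahat_sep x : (forall N, deg_ge N x) -> x = 0.
Proof.
move=> h; rewrite -(ArepK x) -(raddf0 (@Api n)); apply/Api_eq; rewrite subr0.
move=> I hI; apply: hI.1.2 => N.
have [f hf xf] := h N; exists (Arep x - f); last by rewrite opprB addrC subrK.
by have /Api_eq : Api (Arep x) = Api f by [rewrite ArepK]; apply.
Qed.

Lemma Ahat_eq x y : (forall N, deg_ge N (x - y)) -> x = y.
Proof. by move=> h; apply/eqP; rewrite -subr_eq0; apply/eqP/Ahat_sep. Qed.

Lemma two_sided_ideal_deg_ge N : two_sided_ideal (@deg_ge n N).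
Proof.
by split; [exact: subspace_deg_ge | split; [exact: deg_geMl | exact: deg_geMr]].
Qed.

(** Elements of [relset] have no constant term, so no representative of an element of positive
    degree has one. This makes power sums and substitutions computed on representatives
    meaningful. *)
Lemma deg_ge1_Arep x : deg_ge 1 x -> Arep x [::] = 0.
Proof.
move=> [f /ncvalge1P hf ->]; have /relset_constant := Arep_pi f.
by rewrite ncserD -[(- f) _]/(- (f _)) hf subr0.
Qed.

Lemma power_sumP c x N : deg_ge 1 x ->
  deg_ge N (power_sum c x - \sum_(k < N) c k *: x ^+ k).
Proof.
move=> /deg_ge1_Arep hx; rewrite /power_sum; set F := (X in Api X).
have -> : \sum_(k < N) c k *: x ^+ k = Api (\sum_(k < N) c k *: Arep x ^+ k).
  rewrite raddf_sum; apply: eq_bigr => k _ /=.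
  by rewrite linearZ rmorphXn /= ArepK.
rewrite -raddfB; apply: deg_ge_Api => w lw.
rewrite ncserD -[(- _) w]/(- (_ w)) ncser_sum.
rewrite /F (big_ord_widen N (fun k => c k * (Arep x ^+ k) w) lw) big_mkcond /=.
rewrite -sumrB big1 // => k _; case: ltnP => [|hk]; first by rewrite subrr.
by rewrite ncserZ (ncvalgeX hx) ?mulr0 ?subrr.
Qed.

Lemma deg_ge_t i j : deg_ge 1 (t i j : Ahat n).
Proof. by apply: deg_ge_Api; apply/ncvalge1P. Qed.

End Filtration.

(** * Exponential and logarithm *)

Section LowOrder.
Implicit Types p q : {poly rat}.

(** Divisibility by ['X^N]. Evaluation at an element of positive degree sends such polynomials into
    degree [N], so congruences in one commuting variable give the identities between [expA] and
    [logA]. *)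
Definition Xdvd (N : nat) p := forall i, (i < N)%N -> p`_i = 0.

Lemma XdvdD N p q : Xdvd N p -> Xdvd N q -> Xdvd N (p + q).
Proof. by move=> hp hq i iN; rewrite coefD hp // hq // addr0. Qed.

Lemma XdvdN N p : Xdvd N p -> Xdvd N (- p).
Proof. by move=> hp i iN; rewrite coefN hp // oppr0. Qed.

Lemma XdvdMr N p q : Xdvd N p -> Xdvd N (p * q).
Proof.
move=> hp i iN; rewrite coefM big1 // => j _.
by rewrite hp ?mul0r //; apply: leq_ltn_trans iN; rewrite -ltnS.
Qed.

Lemma XdvdP N p : Xdvd N p -> p = drop_poly N p * 'X^N.
Proof.
move=> hp; apply/polyP => i; rewrite coefMXn coef_drop_poly.
by case: ltnP => [/hp //|Ni]; rewrite subnK.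
Qed.

Lemma Xdvd_XnM N p : Xdvd N ('X^N * p).
Proof. by apply: XdvdMr => i iN; rewrite coefXn ltn_eqF. Qed.

Lemma Xdvd_comp N p q : q`_0 = 0 -> Xdvd N p -> Xdvd N (p \Po q).
Proof.
move=> q0 /XdvdP ->; rewrite comp_polyM comp_Xn_poly mulrC.
have /XdvdP -> : Xdvd 1 q by case.
by rewrite expr1 exprMn_comm; [rewrite mulrAC mulrC; exact: Xdvd_XnM | exact: mulrC].
Qed.

Lemma Xdvd_deriv N p : p`_0 = 0 -> Xdvd N p^`() -> Xdvd N.+1 p.
Proof.
move=> p0 hp [//|i] iN; have := hp i iN; rewrite coef_deriv -mulr_natr => /eqP.
by rewrite mulf_eq0 Num.Theory.pnatr_eq0 orbF => /eqP.
Qed.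

Lemma coef0_comp p q : q`_0 = 0 -> (p \Po q)`_0 = p`_0.
Proof. by rewrite -!horner_coef0 horner_comp => ->. Qed.

Definition exp_poly N : {poly rat} := \poly_(k < N) (k`!)%:R^-1.
Definition log_poly N : {poly rat} := \poly_(k < N) ((-1) ^+ k.+1 / k%:R).
Definition geo_poly N : {poly rat} := \poly_(k < N) (-1) ^+ k.

Lemma exp_poly_deriv N : (exp_poly N.+1)^`() = exp_poly N.
Proof.
apply/polyP => i; rewrite coef_deriv !coef_poly ltnS; case: ltnP => _; last first.
  by rewrite mul0rn.
by rewrite -[LHS]mulr_natr factS natrM invfM mulrAC mulVf ?mul1r // Num.Theory.pnatr_eq0.
Qed.

Lemma exp_polyS N : exp_poly N.+1 = exp_poly N + (N`!)%:R^-1 *: 'X^N.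
Proof. by rewrite /exp_poly !poly_def big_ord_recr. Qed.

Lemma exp_poly0 N : (exp_poly N.+1)`_0 = 1.
Proof. by rewrite coef_poly fact0 invr1. Qed.

Lemma log_poly0 N : (log_poly N)`_0 = 0.
Proof. by rewrite coef_poly invr0 mulr0 if_same. Qed.

Lemma log_poly_deriv N : (log_poly N.+1)^`() = geo_poly N.
Proof.
apply/polyP => i; rewrite coef_deriv !coef_poly ltnS; case: ltnP => _; last first.
  by rewrite mul0rn.
rewrite -[LHS]mulr_natr divfK ?Num.Theory.pnatr_eq0 //.
by rewrite !exprS mulrA mulrNN !mul1r.
Qed.

Lemma geo_polyP N : Xdvd N ((1 + 'X) * geo_poly N - 1).
Proof.
suff -> : (1 + 'X) * geo_poly N - 1 = 'X^N * (- (-1) ^+ N)%:P by exact: Xdvd_XnM.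
elim: N => [|N IH].
  by rewrite /geo_poly poly_def big_ord0 mulr0 !expr0 mul1r polyCN sub0r.
have -> : geo_poly N.+1 = geo_poly N + (-1) ^+ N *: 'X^N.
  by rewrite /geo_poly !poly_def big_ord_recr.
rewrite mulrDr addrAC IH -mul_polyC !exprS !mulN1r opprK polyCN.
by rewrite mulrN mulrDl mul1r [X in _ + (X + _)]mulrC addKr [RHS]mulrC mulrCA.
Qed.

(** By differentiation: [geo_poly] is the truncation of 1 / (1 + X), taken here at exp X - 1, so it
    inverts exp. The truncated exp is its own derivative only up to a multiple of ['X^N], which is
    absorbed. *)
Lemma log_exp_poly N : Xdvd N (log_poly N \Po (exp_poly N - 1) - 'X).
Proof.
case: N => // N; set E := exp_poly N.+1.
have E0 : (E - 1)`_0 = 0 by rewrite coefB coef1 exp_poly0 subrr.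
apply: Xdvd_deriv.
  by rewrite coefB coefX subr0 coef0_comp // log_poly0.
rewrite derivB derivX deriv_comp log_poly_deriv derivB derivC subr0.
rewrite exp_poly_deriv; have := Xdvd_comp E0 (@geo_polyP N).
rewrite comp_polyB comp_polyM comp_polyD comp_polyX comp_polyC.
rewrite polyC1 [1 + _]addrC subrK => h.
have -> : exp_poly N = E - (N`!)%:R^-1 *: 'X^N by rewrite /E exp_polyS addrK.
rewrite mulrBr addrAC [_ * E]mulrC; apply: XdvdD h _; apply: XdvdN.
by rewrite -scalerAr scalerAl mulrC; exact: Xdvd_XnM.
Qed.

(** Both exp(log(1 + X)) and 1 + X solve (1 + X) y' = y modulo ['X^N]. Their difference G has no
    constant term, and (i + 1) G_(i+1) + i G_i = G_i makes its coefficients vanish one after the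
    other. *)
Lemma exp_log_poly N : Xdvd N (exp_poly N \Po log_poly N - (1 + 'X)).
Proof.
case: N => // N; set L := log_poly N.+1; set F := _ \Po _.
have L0 : L`_0 = 0 by exact: log_poly0.
have : Xdvd N ((1 + 'X) * F^`() - F).
  rewrite deriv_comp exp_poly_deriv log_poly_deriv mulrCA.
  set e := _ \Po _; have -> : F = e + ((N`!)%:R^-1 *: 'X^N \Po L).
    by rewrite /F exp_polyS comp_polyD.
  rewrite opprD addrA -{2}[e]mulr1 -mulrBr; apply: XdvdD.
    by rewrite mulrC; apply: XdvdMr; exact: geo_polyP.
  apply: XdvdN; apply: Xdvd_comp => //.
  by rewrite -mul_polyC mulrC; exact: Xdvd_XnM.
set G := F - _ => h.
have {}h : Xdvd N ((1 + 'X) * G^`() - G).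
  suff -> : (1 + 'X) * G^`() - G = (1 + 'X) * F^`() - F by [].
  rewrite /G derivB derivD derivC derivX add0r mulrBr mulr1 opprB.
  by rewrite addrA subrK.
have G0 : G`_0 = 0.
  by rewrite /G coefB coefD coefX coef1 addr0 coef0_comp // exp_poly0 subrr.
elim=> [//|i IH]; rewrite ltnS => iN; have := h i iN.
rewrite mulrDl mul1r coefB coefD coefXM !coef_deriv IH 1?ltnW // subr0.
have -> : (if i == 0%N then 0 else G`_i.-1.+1 *+ i.-1.+1) = 0.
  by case: eqP => // /eqP; rewrite -lt0n => /prednK ->; rewrite IH ?mul0rn // ltnW.
by rewrite addr0 -mulr_natr => /eqP; rewrite mulf_eq0 Num.Theory.pnatr_eq0 orbF => /eqP.
Qed.

(** The product has constant term 1, and its derivative vanishes up to the truncation. *)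
Lemma exp_polyVr N : Xdvd N (exp_poly N * (exp_poly N \Po - 'X) - 1).
Proof.
case: N => // N; set E := exp_poly N.+1; have X0 : (- 'X : {poly rat})`_0 = 0.
  by rewrite coefN coefX oppr0.
apply: Xdvd_deriv.
  by rewrite coefB coef1 coef0M coef0_comp // exp_poly0 mulr1 subrr.
rewrite derivB derivC subr0 derivM deriv_comp derivN derivX exp_poly_deriv mulrN1.
have -> : exp_poly N = E - (N`!)%:R^-1 *: 'X^N by rewrite /E exp_polyS addrK.
rewrite comp_polyB.
have E' u v (a b : {poly rat}) : (u - a) * v + u * - (v - b) = - (a * v) + u * b.
  by ring.
rewrite {}E'.
apply: XdvdD; first by apply: XdvdN; rewrite -mul_polyC mulrAC mulrC; exact: Xdvd_XnM.
rewrite mulrC; apply/XdvdMr/Xdvd_comp => //.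
by rewrite -mul_polyC mulrC; exact: Xdvd_XnM.
Qed.

End LowOrder.

Lemma horner_algE (A : algType rat) (x : A) (p : {poly rat}) :
  horner_alg x p = \sum_(k < size p) p`_k *: x ^+ k.
Proof.
rewrite -{1}[p]coefK poly_def raddf_sum /=; apply: eq_bigr => k _ /=.
by rewrite linearZ rmorphXn /= horner_algX mulr_algl.
Qed.

Section TwoSided.
Variables (A : algType rat) (I : set A).
Hypothesis hI : two_sided_ideal I.

Lemma idealMl a x : I x -> I (a * x). Proof. by move/(hI.2 a) => []. Qed.
Lemma idealMr a x : I x -> I (x * a). Proof. by move/(hI.2 a) => []. Qed.

Lemma idealBM x y x' y' : I (x - x') -> I (y - y') -> I (x * y - x' * y').
Proof.
move=> hx hy; rewrite -(subrKA (x' * y)) -mulrBl -mulrBr.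
by apply: (subspaceD hI.1); [exact: idealMr | exact: idealMl].
Qed.

Lemma idealBX x y k : I (x - y) -> I (x ^+ k - y ^+ k).
Proof.
move=> h; elim: k => [|k IH]; first by rewrite subrr; exact: subspace0 hI.1.
by rewrite !exprS; exact: idealBM.
Qed.

Lemma idealB_horner x y p : I (x - y) -> I (horner_alg x p - horner_alg y p).
Proof.
move=> h; rewrite !horner_algE; apply: (subspaceB_sum hI.1) => k _.
exact/(subspaceBZ hI.1)/idealBX.
Qed.

End TwoSided.

Lemma horner_alg_comp (A : algType rat) (x : A) p q :
  horner_alg x (p \Po q) = horner_alg (horner_alg x q) p.
Proof.
rewrite comp_polyE [RHS]horner_algE raddf_sum; apply: eq_bigr => k _ /=.
by rewrite linearZ rmorphXn /= mulr_algl.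
Qed.

Section ExpLog.
Variable n : nat.
Implicit Types (x y z : Ahat n).
Local Notation sF := (@subspace_deg_ge n _).
Local Notation iF := (@two_sided_ideal_deg_ge n _).

Lemma deg_ge_horner N p x : deg_ge 1 x -> Xdvd N p -> deg_ge N (horner_alg x p).
Proof.
move=> hx /XdvdP ->; rewrite rmorphM rmorphXn /= horner_algX.
exact/deg_geMl/deg_geX.
Qed.

Lemma power_sum_poly c x N : deg_ge 1 x ->
  deg_ge N (power_sum c x - horner_alg x (\poly_(k < N) c k)).
Proof.
move=> hx; suff -> : horner_alg x (\poly_(k < N) c k) = \sum_(k < N) c k *: x ^+ k.
  exact: power_sumP.
rewrite poly_def raddf_sum; apply: eq_bigr => k _ /=.
by rewrite linearZ rmorphXn /= horner_algX mulr_algl.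
Qed.

(** Polynomials respect congruences modulo a two-sided ideal, and closedness allows passing to the
    limit. This carries congruences modulo 1FF through [expA] and [logA]. *)
Lemma power_sum_ideal (I : set (Ahat n)) c x y :
  two_sided_ideal I -> fclosed (@deg_ge n) I -> deg_ge 1 x -> deg_ge 1 y ->
  I (x - y) -> I (power_sum c x - power_sum c y).
Proof.
move=> hI cI hx hy hxy; apply: cI => N.
set p := \poly_(k < N) c k.
exists (horner_alg x p - horner_alg y p); first exact: idealB_horner.
exact: (subspaceBB sF) (power_sum_poly _ _ hx) (power_sum_poly _ _ hy).
Qed.

Lemma expA_poly x N : deg_ge 1 x -> deg_ge N (expA x - horner_alg x (exp_poly N)).
Proof. exact: power_sum_poly. Qed.

Lemma logA_poly x N : deg_ge 1 (x - 1) ->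
  deg_ge N (logA x - horner_alg (x - 1) (log_poly N)).
Proof. exact: power_sum_poly. Qed.

Lemma expA_sub1 x : deg_ge 1 x -> deg_ge 1 (expA x - 1).
Proof.
move=> hx; apply: (subspaceBt sF) (expA_poly 1 hx) _.
by rewrite /exp_poly poly_def big_ord1 fact0 invr1 scale1r expr0 rmorph1 subrr;
   exact: (subspace0 sF).
Qed.

Lemma deg_ge1_logA x : deg_ge 1 (x - 1) -> deg_ge 1 (logA x).
Proof.
move=> hx; apply: (subspaceB_in sF) (logA_poly 1 hx) _.
by apply: deg_ge_horner => // -[] // _; rewrite log_poly0.
Qed.

Lemma logA_expA x : deg_ge 1 x -> logA (expA x) = x.
Proof.
move=> hx; apply: Ahat_eq => N.
have h1 := expA_sub1 hx; apply: (subspaceBt sF) (logA_poly N h1) _.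
have h2 : deg_ge N (expA x - 1 - horner_alg x (exp_poly N - 1)).
  rewrite rmorphB rmorph1; apply: (subspaceBB sF) (expA_poly N hx) _.
  by rewrite subrr; exact: (subspace0 sF).
apply: (subspaceBt sF) (idealB_horner iF (log_poly N) h2) _.
rewrite -horner_alg_comp -{2}(horner_algX x) -rmorphB.
exact/deg_ge_horner/log_exp_poly.
Qed.

Lemma expA_logA x : deg_ge 1 (x - 1) -> expA (logA x) = x.
Proof.
move=> hx; apply: Ahat_eq => N.
have h1 := deg_ge1_logA hx; apply: (subspaceBt sF) (expA_poly N h1) _.
apply: (subspaceBt sF) (idealB_horner iF (exp_poly N) (logA_poly N hx)) _.
have e : x = horner_alg (x - 1) (1 + 'X).
  by rewrite rmorphD rmorph1 /= horner_algX addrC subrK.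
rewrite -horner_alg_comp [X in _ - X]e -rmorphB.
exact/deg_ge_horner/exp_log_poly.
Qed.

Lemma expA_mulN x : deg_ge 1 x -> expA x * expA (- x) = 1.
Proof.
move=> hx; have hNx := subspaceN sF hx; apply: Ahat_eq => N.
apply: (subspaceBt sF) (idealBM iF (expA_poly N hx) (expA_poly N hNx)) _.
rewrite -{2}(horner_algX x) -rmorphN -horner_alg_comp -rmorphM.
rewrite -(rmorph1 (horner_alg x)) -rmorphB.
exact/deg_ge_horner/exp_polyVr.
Qed.

Lemma expA_Nmul x : deg_ge 1 x -> expA (- x) * expA x = 1.
Proof.
by move=> hx; rewrite -{2}[x]opprK expA_mulN //; exact: (subspaceN sF).
Qed.

Lemma expAV x : deg_ge 1 x -> (expA x)^-1 = expA (- x).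
Proof.
move=> hx; have hu : expA x \is a GRing.unit.
  by apply/unitrP; exists (expA (- x)); rewrite expA_mulN ?expA_Nmul.
by apply: (mulrI hu); rewrite divrr // expA_mulN.
Qed.

End ExpLog.

(** * Group-like elements *)

Section LieSubalgebra.
Variable n : nat.
Implicit Types (x y z : Ahat n).
Local Notation sF := (@subspace_deg_ge n _).

Lemma Lhat_lie : lie_subalgebra (@Lhat n).
Proof.
split; first split.
- by move=> I [[[[]]]].
- by move=> a x y hx hy I hI; apply: hI.1.1.1.2; [exact: hx | exact: hy].
- by move=> x y hx hy I hI; apply: hI.1.1.2; [exact: hx | exact: hy].
Qed.

Lemma Lhat_fclosed : fclosed (@deg_ge n) (@Lhat n).
Proof.
move=> x hx I hI; apply: hI.1.2 => N.
by have [y hy xy] := hx N; exists y => //; exact: hy.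
Qed.

Lemma Lhat_t i j : strands n [:: i; j] -> Lhat (t i j : Ahat n).
Proof. by move=> h I hI; apply: hI.2; exists i, j. Qed.

Lemma Lhat_ind (I : set (Ahat n)) :
  lie_subalgebra I -> fclosed (@deg_ge n) I ->
  (forall i j, strands n [:: i; j] -> I (t i j)) -> @Lhat n `<=` I.
Proof.
by move=> h1 h2 h3 x; apply; split=> // _ [i [j [hij ->]]]; exact: h3.
Qed.

Lemma subspace_Lhat : subspace (@Lhat n). Proof. exact: Lhat_lie.1. Qed.
Local Notation sL := subspace_Lhat.

Lemma Lhat_bracket x y : Lhat x -> Lhat y -> Lhat (bracket x y).
Proof. exact: Lhat_lie.2. Qed.

Lemma fclosed_deg_ge M : fclosed (@deg_ge n) (deg_ge M).
Proof. by move=> x /(_ M)[y hy xy]; exact: (subspaceB_in sF) xy hy. Qed.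

Lemma Lhat_deg_ge1 x : Lhat x -> deg_ge 1 x.
Proof.
move: x; apply: Lhat_ind; last by move=> i j _; exact: deg_ge_t.
  split; first exact: sF.
  by move=> x y hx hy; exact: deg_ge_le (deg_ge_bracket hx hy).
exact: fclosed_deg_ge.
Qed.

End LieSubalgebra.

(** * The degree derivation *)

Definition ncdeg (G : Type) (f : ncseries G) : ncseries G :=
  fun w => (size w)%:R * f w.

Section SeriesDegree.
Variable G : Type.
Implicit Types f g : ncseries G.

Lemma ncdeg_linear a f g : ncdeg (a *: f + g) = a *: ncdeg f + ncdeg g.
Proof.
apply/funext => w; rewrite /ncdeg ncserD ncserZ [RHS]ncserD ncserZ.
by rewrite mulrDr mulrCA.
Qed.

Lemma ncdegM f g : ncdeg (f * g) = ncdeg f * g + f * ncdeg g.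
Proof.
apply/funext => w; rewrite [RHS]ncserD /ncdeg !ncserM mulr_sumr -big_split /=.
apply: eq_bigr => k _; rewrite size_takel -1?ltnS // size_drop.
have kw : (k <= size w)%N by rewrite -ltnS.
by rewrite -{1}(subnKC kw) natrD mulrDl mulrA [in X in _ + X]mulrCA.
Qed.

Lemma ncdeg_ge N f : ncvalge N f -> ncvalge N (ncdeg f).
Proof. by move=> hf w lw; rewrite /ncdeg hf // mulr0. Qed.

Lemma ncdeg_lead N f : ncvalge N f -> ncvalge N.+1 (ncdeg f - N%:R *: f).
Proof.
move=> hf w; rewrite ltnS ncserD -[(- _) w]/(- (_ w)) ncserZ /ncdeg.
rewrite leq_eqVlt => /orP[/eqP ->|lw]; first by rewrite subrr.
by rewrite hf // !mulr0 subrr.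
Qed.

End SeriesDegree.

Section DegreeDerivation.
Variable n : nat.
Implicit Types (f g : ncseries (chord n)) (x y z c : Ahat n).
Local Notation sF := (@subspace_deg_ge n _).

Lemma ncdeg0 (G : Type) : ncdeg (0 : ncseries G) = 0.
Proof. by apply/funext => w; rewrite /ncdeg mulr0. Qed.

Lemma ncdegD (G : Type) (f g : ncseries G) : ncdeg (f + g) = ncdeg f + ncdeg g.
Proof. by rewrite -[f]scale1r ncdeg_linear !scale1r. Qed.

Lemma ncdegB (G : Type) (f g : ncseries G) : ncdeg (f - g) = ncdeg f - ncdeg g.
Proof. by rewrite addrC -scaleN1r ncdeg_linear scaleN1r addrC. Qed.

Lemma ncdeg_tser i j : ncdeg (tser n i j) = tser n i j.
Proof. by apply/funext => -[|? []] *; rewrite /ncdeg ?mulr0 // mul1r. Qed.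

Lemma closed_ideal_relset : closed_ideal_series (relset n).
Proof.
split; first exact: relset_ideal.
move=> f hf I hI; apply: hI.1.2 => N.
by have [g hg fg] := hf N; exists g => //; exact: hg.
Qed.

Lemma relset_relator r : relators n r -> relset n r.
Proof. by move=> hr I [_]; apply. Qed.

(** Relators are homogeneous of degree 2, so they are multiplied by 2, and the Leibniz rule extends
    this to the closed ideal. Membership of [f] itself is carried along because Leibniz also
    produces a term with [f] undifferentiated. *)
Lemma ncdeg_relset f : relset n f -> relset n (ncdeg f).
Proof.
have [[sR mR] cR] := closed_ideal_relset.
move=> hf; suff [] : relset n f /\ relset n (ncdeg f) by [].
apply: (hf [set f | relset n f /\ relset n (ncdeg f)]); split; last first.
  have br d e : ncdeg d = d -> ncdeg e = e ->
      ncdeg (bracket d e) = 2%:R *: bracket d e.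
    move=> hd he; rewrite /bracket ncdegB !ncdegM hd he.
    by rewrite scaler_nat mulr2n opprD addrACA.
  move=> r hr; have rr := relset_relator hr; split=> //.
  suff -> : ncdeg r = 2%:R *: r by exact: (subspaceZ sR).
  case: hr => [[i [j [k [_ ->]]]]|[i [j [k [l [_ ->]]]]]];
    by apply: br; rewrite ?ncdegD !ncdeg_tser.
split; first split; first split.
- by split; rewrite ?ncdeg0; exact: (subspace0 sR).
- move=> a x y [h1 h2] [h3 h4]; split; first exact: sR.2.
  by rewrite ncdeg_linear; exact: sR.2.
- move=> a x [h1 h2]; split; split; rewrite ?ncdegM.
  + by have [] := mR a x h1.
  + by apply: (subspaceD sR); [have [] := mR (ncdeg a) x h1|have [] := mR a _ h2].
  + by have [] := mR a x h1.
  + by apply: (subspaceD sR); [have [] := mR a _ h2|have [] := mR (ncdeg a) x h1].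
- move=> x hx; split; apply: cR => N; have [y [h1 h2] xy] := hx N; first by exists y.
  by exists (ncdeg y) => //; rewrite -ncdegB; exact: ncdeg_ge.
Qed.

Definition Adeg x : Ahat n := Api (ncdeg (Arep x)).

Lemma Adeg_Api f : Adeg (Api f) = Api (ncdeg f).
Proof. by apply/Api_eq; rewrite -ncdegB; apply: ncdeg_relset; exact: Arep_pi. Qed.

Lemma Adeg_linear a x y : Adeg (a *: x + y) = a *: Adeg x + Adeg y.
Proof.
rewrite -(ArepK x) -(ArepK y) -linearP !Adeg_Api ncdeg_linear.
by rewrite -linearP.
Qed.

Lemma AdegB x y : Adeg (x - y) = Adeg x - Adeg y.
Proof. by rewrite addrC -scaleN1r Adeg_linear scaleN1r addrC. Qed.

Lemma Adeg0 : Adeg 0 = 0.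
Proof. by have := AdegB 0 0; rewrite !subrr. Qed.

Lemma AdegZ a x : Adeg (a *: x) = a *: Adeg x.
Proof. by rewrite -[a *: x]addr0 Adeg_linear Adeg0 addr0. Qed.

Lemma Adeg_sum (J : Type) (r : seq J) (P : pred J) (F : J -> Ahat n) :
  Adeg (\sum_(j <- r | P j) F j) = \sum_(j <- r | P j) Adeg (F j).
Proof.
elim/big_rec2: _ => [|j x y _ <-]; first exact: Adeg0.
by rewrite -[F j]scale1r Adeg_linear !scale1r.
Qed.

Lemma AdegM x y : Adeg (x * y) = Adeg x * y + x * Adeg y.
Proof.
by rewrite -(ArepK x) -(ArepK y) -rmorphM !Adeg_Api ncdegM raddfD /= !rmorphM.
Qed.

Lemma Adeg1 : Adeg 1 = 0.
Proof.
have /eqP := AdegM 1 1; rewrite !mul1r mulr1 -subr_eq0 opprD addrA subrr sub0r.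
by rewrite oppr_eq0 => /eqP.
Qed.

Lemma Adeg_ge N x : deg_ge N x -> deg_ge N (Adeg x).
Proof.
by move=> [f hf ->]; rewrite Adeg_Api; exists (ncdeg f) => //; exact: ncdeg_ge.
Qed.

(** What makes the derivation invertible, one positive degree at a time, over the rationals. *)
Lemma Adeg_lead N x : deg_ge N x -> deg_ge N.+1 (Adeg x - N%:R *: x).
Proof.
move=> [f hf ->]; rewrite Adeg_Api -linearZ -raddfB.
exact/deg_ge_Api/ncdeg_lead.
Qed.

Lemma Lhat_Adeg x : Lhat x -> Lhat (Adeg x).
Proof.
have sL := subspace_Lhat n.
suff h : @Lhat n `<=` [set x | Lhat x /\ Lhat (Adeg x)] by move=> /h[].
apply: Lhat_ind => {x}.
- split; first split.
  + by split; rewrite ?Adeg0; exact: (subspace0 sL).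
  + by move=> a x y [h1 h2] [h3 h4]; split; rewrite ?Adeg_linear; apply: sL.2.
  + move=> x y [h1 h2] [h3 h4]; split; first exact: Lhat_bracket.
    rewrite /bracket AdegB !AdegM.
    rewrite [X in _ - X]addrC opprD addrACA.
    by apply: (subspaceD sL); exact: Lhat_bracket.
- move=> y hy; split; apply: Lhat_fclosed => N; have [z [h1 h2] yz] := hy N.
    by exists z.
  by exists (Adeg z) => //; rewrite -AdegB; exact: Adeg_ge.
- move=> i j hij; have ht := Lhat_t hij; split=> //.
  by rewrite /t Adeg_Api ncdeg_tser.
Qed.

End DegreeDerivation.

(** * Logarithmic derivatives and products of exponentials *)

Lemma sum_pascal (V : zmodType) (F : nat -> V) m :
  \sum_(k < m.+2) F k *+ 'C(m.+1, k) = \sum_(k < m.+1) (F k + F k.+1) *+ 'C(m, k).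
Proof.
under [RHS]eq_bigr => k _ do rewrite mulrnDl.
rewrite big_split /= big_ord_recl /= bin0.
under eq_bigr => k _ do rewrite /bump /= add1n binS mulrnDr.
rewrite big_split /= addrA; congr (_ + _).
transitivity (\sum_(k < m.+2) F k *+ 'C(m, k)).
  by rewrite [RHS]big_ord_recl /= bin0.
by rewrite big_ord_recr /= bin_small // mulr0n addr0.
Qed.

Section IteratedBracket.
Variable A : algType rat.
Implicit Types c x y z : A.

Definition iter_bracket c x k := iter k (fun z => bracket z c) x.

(** Right multiplication by [c] is left multiplication by [c] plus the bracket with [c]. These two
    operators commute, so this is the binomial formula. *)
Lemma mulX_iter_bracket c x m :
  x * c ^+ m = \sum_(k < m.+1) (c ^+ (m - k) * iter_bracket c x k) *+ 'C(m, k).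
Proof.
elim: m => [|m IH].
  by rewrite big_ord_recl big_ord0 /= subn0 !expr0 mul1r mulr1 addr0.
rewrite (sum_pascal (fun k => c ^+ (m.+1 - k) * iter_bracket c x k)).
rewrite exprSr mulrA IH mulr_suml; apply: eq_bigr => k _.
rewrite mulrnAl; congr (_ *+ _); have km : (k <= m)%N by rewrite -ltnS.
by rewrite subSS subSn // exprSr -!mulrA -mulrDr /= /bracket addrC subrK.
Qed.

End IteratedBracket.

Section BCH.
Variable n : nat.
Implicit Types (x y z c : Ahat n).
Local Notation sF := (@subspace_deg_ge n _).
Local Notation iF := (@two_sided_ideal_deg_ge n _).
Local Notation sL := (@subspace_Lhat n).

Lemma Adeg_X c m :
  Adeg (c ^+ m) =
    \sum_(k < m) (c ^+ (m - k.+1) * iter_bracket c (Adeg c) k) *+ 'C(m, k.+1).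
Proof.
elim: m => [|m IH]; first by rewrite big_ord0 Adeg1.
rewrite exprS AdegM IH mulX_iter_bracket addrC.
transitivity (\sum_(k < m.+1) ((c ^+ (m - k) * iter_bracket c (Adeg c) k) *+ 'C(m, k.+1)
   + (c ^+ (m - k) * iter_bracket c (Adeg c) k) *+ 'C(m, k))); last first.
  by apply: eq_bigr => k _; rewrite -mulrnDr subSS binS.
rewrite big_split /=; congr (_ + _).
rewrite [RHS]big_ord_recr /= bin_small // mulr0n addr0 mulr_sumr; apply: eq_bigr => k _.
by rewrite mulrnAr mulrA -exprS subnSK.
Qed.

Lemma deg_ge_iter_bracket M c x k :
  deg_ge 1 c -> deg_ge M x -> deg_ge (M + k) (iter_bracket c x k).
Proof.
move=> hc hx; elim: k => [|k IH]; first by rewrite addn0.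
by rewrite addnS -addn1; exact: deg_ge_bracket.
Qed.

(** The triangle of index pairs with sum below [N] and the full square differ only in terms of
    degree at least [N]. This matches a product of truncated series with its Cauchy product. *)
Lemma deg_ge_cauchy N (F : nat -> nat -> Ahat n) :
  (forall m k, (N <= m + k)%N -> deg_ge N (F m k)) ->
  deg_ge N (\sum_(m < N) \sum_(k < m.+1) F (m - k)%N k
            - \sum_(m < N) \sum_(k < N) F m k).
Proof.
move=> hF; rewrite [X in _ - X]exchange_big /=.
have -> : \sum_(m < N) \sum_(k < m.+1) F (m - k)%N k =
    \sum_(k < N) \sum_(m < N | (k <= m)%N) F (m - k)%N k.
  rewrite [RHS](exchange_big_dep xpredT) //=; apply: eq_bigr => m _.
  by rewrite (big_ord_widen N (fun k => F (m - k)%N k)).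
apply: (subspaceB_sum sF) => k _.
have -> : \sum_(m < N | (k <= m)%N) F (m - k)%N k = \sum_(m < N - k) F m k.
  rewrite -(big_mkord (fun m => true && (k <= m)%N) (fun m => F (m - k)%N k)).
  rewrite -(big_nat_widenl k 0 N xpredT) // -{1}[k : nat]add0n big_addn.
  by rewrite big_mkord; apply: eq_bigr => m _; rewrite addnK.
rewrite (big_ord_widen N (fun m => F m k)) ?leq_subr //.
rewrite [X in _ - X](bigID (fun m : 'I_N => (m < N - k)%N)) /= opprD addNKr.
apply: (subspaceN sF); apply: (subspace_sum sF) => m.
by rewrite -leqNgt leq_subLR addnC => /hF.
Qed.

Lemma binr_fact m k : (k <= m)%N ->
  (m`!)%:R^-1 *+ 'C(m, k) = ((m - k)`!)%:R^-1 * (k`!)%:R^-1 :> rat.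
Proof.
move=> km; have nz i : (i`!)%:R != 0 :> rat.
  by rewrite Num.Theory.pnatr_eq0 -lt0n fact_gt0.
rewrite -invfM -natrM mulnC; apply: (mulfI (nz m)).
rewrite mulrnAr divff // -[in RHS](bin_fact km) natrM.
by rewrite mulfK // natrM mulf_neq0.
Qed.

(** Truncated form of exp(-c) x exp(c) = exp(ad) x, with ad the right bracket with [c], multiplied
    by exp(c) to avoid the inverse. *)
Lemma mul_expA_iter_bracket c x N : deg_ge 1 c ->
  deg_ge N (x * expA c - expA c * \sum_(k < N) (k`!)%:R^-1 *: iter_bracket c x k).
Proof.
move=> hc; have hE := power_sumP (fun k => (k`!)%:R^-1) N hc.
have hxx : deg_ge N (x - x) by rewrite subrr; exact: (subspace0 sF).
apply: (subspaceBt sF) (idealBM iF hxx hE) _.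
set S := \sum_(k < N) _ *: iter_bracket _ _ _.
have hSS : deg_ge N (S - S) by rewrite subrr; exact: (subspace0 sF).
apply: (subspaceBt sF) (subspaceBC sF (idealBM iF hE hSS)).
have -> : x * \sum_(m < N) (m`!)%:R^-1 *: c ^+ m = \sum_(m < N) \sum_(k < m.+1)
    (((m - k)`!)%:R^-1 *: c ^+ (m - k)) * ((k`!)%:R^-1 *: iter_bracket c x k).
  rewrite mulr_sumr; apply: eq_bigr => m _.
  rewrite -scalerAr mulX_iter_bracket scaler_sumr; apply: eq_bigr => k _.
  by rewrite -scalerAl -scalerAr scalerA -binr_fact -1?ltnS // -scalerMnl scalerMnr.
have -> : (\sum_(m < N) (m`!)%:R^-1 *: c ^+ m) * S = \sum_(m < N) \sum_(k < N)
    ((m`!)%:R^-1 *: c ^+ m) * ((k`!)%:R^-1 *: iter_bracket c x k).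
  by rewrite mulr_suml; apply: eq_bigr => m _; rewrite mulr_sumr.
apply: (deg_ge_cauchy (F := fun m k => ((m`!)%:R^-1 *: c ^+ m) *
   ((k`!)%:R^-1 *: iter_bracket c x k))).
move=> m k h; apply: (deg_ge_le h); apply: deg_geM; apply: (subspaceZ sF).
  exact: deg_geX.
by rewrite -[k]add0n; apply: deg_ge_iter_bracket => //; exact: deg_ge0.
Qed.

Lemma Adeg_expA c N : deg_ge 1 c ->
  deg_ge N (Adeg (expA c)
    - expA c * \sum_(k < N) ((k.+1)`!)%:R^-1 *: iter_bracket c (Adeg c) k).
Proof.
move=> hc; have hE := power_sumP (fun k => (k`!)%:R^-1) N hc.
(* One term more than [N]: the derivation kills the constant term, so [N] terms remain once the
   index is shifted. *)
have hE1 := power_sumP (fun k => (k`!)%:R^-1) N.+1 hc.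
have := Adeg_ge (deg_ge_le (leqnSn N) hE1); rewrite AdegB => hA.
apply: (subspaceBt sF) hA _.
set S := \sum_(k < N) _ *: iter_bracket _ _ _.
have hSS : deg_ge N (S - S) by rewrite subrr; exact: (subspace0 sF).
apply: (subspaceBt sF) (subspaceBC sF (idealBM iF hE hSS)).
have -> : Adeg (\sum_(m < N.+1) (m`!)%:R^-1 *: c ^+ m) =
    \sum_(m < N) \sum_(k < m.+1) (((m - k)`!)%:R^-1 *: c ^+ (m - k))
      * (((k.+1)`!)%:R^-1 *: iter_bracket c (Adeg c) k).
  rewrite Adeg_sum big_ord_recl /= AdegZ Adeg1 scaler0 add0r; apply: eq_bigr => m _.
  rewrite AdegZ Adeg_X scaler_sumr; apply: eq_bigr => k _.
  have kb : ((m - k)`!)%:R^-1 * ((k.+1)`!)%:R^-1 =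
      (m.+1`!)%:R^-1 *+ 'C(m.+1, k.+1) :> rat.
    by rewrite binr_fact ?subSS //; exact: (ltn_ord k).
  by rewrite -scalerAl -scalerAr scalerA kb -scalerMnl scalerMnr.
have -> : (\sum_(m < N) (m`!)%:R^-1 *: c ^+ m) * S = \sum_(m < N) \sum_(k < N)
    ((m`!)%:R^-1 *: c ^+ m) * (((k.+1)`!)%:R^-1 *: iter_bracket c (Adeg c) k).
  by rewrite mulr_suml; apply: eq_bigr => m _; rewrite mulr_sumr.
apply: (deg_ge_cauchy (F := fun m k => ((m`!)%:R^-1 *: c ^+ m) *
   (((k.+1)`!)%:R^-1 *: iter_bracket c (Adeg c) k))).
move=> m k h; apply: (deg_ge_le h); apply: deg_geM; apply: (subspaceZ sF).
  exact: deg_geX.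
by rewrite -[k]add0n; apply: deg_ge_iter_bracket => //; exact: deg_ge0.
Qed.

Lemma Lhat_iter_bracket c x k : Lhat c -> Lhat x -> Lhat (iter_bracket c x k).
Proof. by move=> hc hx; elim: k => //= k IH; exact: Lhat_bracket. Qed.

Lemma unitr_expA c : deg_ge 1 c -> expA c \is a GRing.unit.
Proof. by move=> hc; apply/unitrP; exists (expA (- c)); rewrite expA_mulN ?expA_Nmul. Qed.

Lemma deg_geBVl N c x y : deg_ge 1 c ->
  deg_ge N (x - expA c * y) -> deg_ge N ((expA c)^-1 * x - y).
Proof.
move=> hc /(deg_geMl (expA c)^-1).
by rewrite mulrBr mulKr //; exact: unitr_expA.
Qed.

Lemma Lhat_conj c x : Lhat c -> Lhat x -> Lhat ((expA c)^-1 * (x * expA c)).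
Proof.
move=> hc hx; have c1 := Lhat_deg_ge1 hc; apply: Lhat_fclosed => N.
exists (\sum_(k < N) (k`!)%:R^-1 *: iter_bracket c x k).
  by apply: (subspace_sum sL) => k _; apply: (subspaceZ sL); apply: Lhat_iter_bracket.
exact/deg_geBVl/mul_expA_iter_bracket.
Qed.

(* [Adeg] is a derivation, so this is a noncommutative logarithmic derivative. *)
Definition log_deg x := x^-1 * Adeg x.

Lemma log_deg_expA c N : deg_ge 1 c ->
  deg_ge N (log_deg (expA c)
    - \sum_(k < N) ((k.+1)`!)%:R^-1 *: iter_bracket c (Adeg c) k).
Proof. by move=> hc; exact/deg_geBVl/Adeg_expA. Qed.

Lemma Lhat_log_deg c : Lhat c -> Lhat (log_deg (expA c)).
Proof.
move=> hc; have c1 := Lhat_deg_ge1 hc; apply: Lhat_fclosed => N.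
exists (\sum_(k < N) ((k.+1)`!)%:R^-1 *: iter_bracket c (Adeg c) k).
  apply: (subspace_sum sL) => k _; apply: (subspaceZ sL); apply: Lhat_iter_bracket => //.
  exact: Lhat_Adeg.
exact: log_deg_expA.
Qed.

(** A Lie approximation [l] of [c] is improved degree by degree: the logarithmic derivative
    determines D c up to brackets in which the current error appears one degree higher, and D is
    inverted by dividing by the degree. *)
Lemma Lhat_of_log_deg c : deg_ge 1 c -> Lhat (log_deg (expA c)) -> Lhat c.
Proof.
move=> hc hW; apply: Lhat_fclosed; case=> [|N].
  by exists 0; [exact: (subspace0 sL) | exact: deg_ge0].
elim: N => [|N [l hl cl]].
  by exists 0; rewrite ?subr0 //; exact: (subspace0 sL).
(* The terms of the logarithmic derivative after the first one, D a. Each contains a bracket with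
   [a], so an error of degree N + 1 in [a] is felt only from degree N + 2 on. *)
pose T (a : Ahat n) := \sum_(k < N.+1) ((k.+2)`!)%:R^-1 *: iter_bracket a (Adeg a) k.+1.
have hd k : deg_ge (N.+1 + k) (iter_bracket c (Adeg c) k - iter_bracket l (Adeg l) k).
  elim: k => [|k IH]; first by rewrite addn0 -AdegB; exact: Adeg_ge.
  rewrite /= -(subrKA (bracket (iter_bracket l (Adeg l) k) c)).
  rewrite -bracketBl -bracketBr; apply: (subspaceD sF).
    by rewrite addnS -addn1; exact: deg_ge_bracket.
  rewrite addnC; apply: deg_ge_bracket => //.
  rewrite -add1n; apply: deg_ge_iter_bracket; first exact: Lhat_deg_ge1.
  exact: Lhat_deg_ge1 (Lhat_Adeg hl).
have hT : deg_ge N.+2 (T c - T l).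
  apply: (subspaceB_sum sF) => k _; apply: (subspaceBZ sF).
  by apply: deg_ge_le (hd _); rewrite addnS ltnS leq_addr.
have hTl : Lhat (T l).
  apply: (subspace_sum sL) => k _; apply: (subspaceZ sL); apply: Lhat_iter_bracket => //.
  exact: Lhat_Adeg.
have hA : deg_ge N.+2 (Adeg c - (log_deg (expA c) - T l)).
  have := log_deg_expA N.+2 hc; rewrite big_ord_recl invr1 scale1r.
  rewrite (_ : \sum_(k < N.+1) _ = T c) => [/(subspaceN sF) h|]; last exact: eq_bigr.
  have := subspaceB sF h hT; congr (deg_ge _).
  rewrite !opprB addrAC -[_ + T c + _]addrA [T c + _]addrC subrK.
  by rewrite -addrA.
have hr : deg_ge N.+2 (N.+1%:R *: (c - l) - (Adeg c - Adeg l)).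
  by apply: (subspaceBC sF); rewrite -AdegB; exact: Adeg_lead.
set m := log_deg (expA c) - T l in hA.
have hm : deg_ge N.+2 (N.+1%:R *: (c - l) - (m - Adeg l)).
  apply: (subspaceBt sF) hr _; apply: (subspaceBB sF) hA _.
  by rewrite subrr; exact: (subspace0 sF).
(* Solution for [c] of (N + 1)(c - l) = D c - D l, which holds up to degree N + 2, with the Lie
   element [m] in place of D c. *)
exists (l + N.+1%:R^-1 *: (m - Adeg l)).
  apply: (subspaceD sL) => //; apply: (subspaceZ sL); apply: (subspaceB sL).
    by rewrite /m; exact: (subspaceB sL hW hTl).
  exact: Lhat_Adeg.
have := subspaceZ sF N.+1%:R^-1 hm; rewrite scalerBr scalerA mulVf ?scale1r.
  by rewrite opprD addrA.
by rewrite Num.Theory.pnatr_eq0.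
Qed.

Lemma grouplikeM x y : grouplike x -> grouplike y -> grouplike (x * y).
Proof.
move=> [a ha ->] [b hb ->]; have a1 := Lhat_deg_ge1 ha; have b1 := Lhat_deg_ge1 hb.
have h1 : deg_ge 1 (expA a * expA b - 1).
  by rewrite -[X in _ - X]mulr1; apply: (idealBM iF); exact: expA_sub1.
exists (logA (expA a * expA b)); last by rewrite expA_logA.
apply: Lhat_of_log_deg; first exact: deg_ge1_logA.
rewrite expA_logA // /log_deg AdegM invrM ?unitr_expA // mulrDr.
apply: (subspaceD sL).
  rewrite -mulrA [X in _ * X]mulrA; apply: Lhat_conj => //.
  exact: Lhat_log_deg.
by rewrite -mulrA mulKr ?unitr_expA //; exact: Lhat_log_deg.
Qed.

End BCH.

(** * Algebra maps *)

Section Substitution.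
Variables (G : finType) (H : Type) (F : G -> ncseries H).
Hypothesis F1 : forall c, ncvalge 1 (F c).
Implicit Types f g : ncseries G.
Local Notation sV := (@subspace_ncvalge _ _).

Definition ncsubst_term k f : ncseries H :=
  \sum_(v : k.-tuple G) f v *: \prod_(c <- v) F c.

Lemma ncvalge_prod (v : seq G) : ncvalge (size v) (\prod_(c <- v) F c).
Proof.
elim: v => [|c v IH]; first exact: ncvalge0.
by rewrite big_cons /= -add1n; exact: ncvalgeM.
Qed.

Lemma ncvalge_subst_term k f : ncvalge k (ncsubst_term k f).
Proof.
apply: (subspace_sum sV) => v _; apply: (subspaceZ sV).
by rewrite -{1}(size_tuple v); exact: ncvalge_prod.
Qed.

Lemma ncsubst_trunc N f :
  ncvalge N (ncsubst F f - \sum_(k < N) ncsubst_term k f).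
Proof.
move=> w lw; rewrite ncserD -[(- _) w]/(- (_ w)) ncser_sum.
have -> : ncsubst F f w = \sum_(k < (size w).+1) ncsubst_term k f w.
  by apply: eq_bigr => k _; rewrite /ncsubst_term ncser_sum.
rewrite (big_ord_widen N (fun k => ncsubst_term k f w) lw) big_mkcond /=.
rewrite -sumrB big1 // => k _; case: ltnP => [|hk]; first by rewrite subrr.
by rewrite (ncvalge_subst_term f) ?subrr.
Qed.

Lemma ncser_eq (f g : ncseries H) : (forall N, ncvalge N (f - g)) -> f = g.
Proof.
move=> h; apply/funext => w; apply/eqP; rewrite -subr_eq0; apply/eqP.
exact: (h (size w).+1 w (ltnSn _)).
Qed.

Lemma ncsubst_term0 f : ncsubst_term 0 f = f [::] *: 1.
Proof.
rewrite /ncsubst_term (bigD1 [tuple]) //= big_nil big1 ?addr0 // => v.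
by case/eqP; exact: tuple0.
Qed.

Lemma ncsubst_termS k f :
  ncsubst_term k.+1 f = \sum_c F c * ncsubst_term k (ncshift c f).
Proof.
rewrite /ncsubst_term; under [RHS]eq_bigr => c _ do rewrite mulr_sumr.
rewrite pair_big /=.
rewrite (reindex (fun p : G * k.-tuple G => [tuple of p.1 :: p.2])) /=.
  by apply: eq_bigr => -[c v] _; rewrite big_cons -scalerAr.
exists (fun v : k.+1.-tuple G => (thead v, [tuple of behead v])) => [[c v] _|v _].
  by rewrite /= theadE; congr pair; apply/val_inj.
by rewrite [v in RHS]tuple_eta; apply/val_inj.
Qed.

Lemma ncsubst_rec f :
  ncsubst F f = f [::] *: 1 + \sum_c F c * ncsubst F (ncshift c f).
Proof.
apply: ncser_eq => -[|N]; first exact: ncvalge0.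
apply: (subspaceBt sV) (@ncsubst_trunc N.+1 f) _.
rewrite big_ord_recl ncsubst_term0; apply: (subspaceBD sV).
  by rewrite subrr; exact: (subspace0 sV).
rewrite (eq_bigr (fun k : 'I_N => \sum_c F c * ncsubst_term k (ncshift c f))); last first.
  by move=> k _; rewrite -ncsubst_termS.
rewrite exchange_big; apply: (subspaceB_sum sV) => c _.
rewrite -mulr_sumr -mulrBr -add1n; apply: ncvalgeM => //.
exact/(subspaceBC sV)/ncsubst_trunc.
Qed.

Lemma ncsubst_linear a f g : ncsubst F (a *: f + g) = a *: ncsubst F f + ncsubst F g.
Proof.
apply/funext => w; rewrite ncserD ncserZ /ncsubst mulr_sumr -big_split /=.
apply: eq_bigr => k _; rewrite mulr_sumr -big_split /=.
by apply: eq_bigr => v _; rewrite ncserD ncserZ mulrDl mulrA.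
Qed.

Lemma ncsubst0 : ncsubst F 0 = 0.
Proof.
apply/funext => w; rewrite /ncsubst big1 // => k _; rewrite big1 // => v _.
by rewrite mul0r.
Qed.

Lemma ncsubst_valge N f : ncvalge N f -> ncvalge N (ncsubst F f).
Proof.
move=> hf w lw; rewrite /ncsubst big1 // => k _; rewrite big1 // => v _.
rewrite hf ?mul0r // size_tuple; apply: leq_ltn_trans lw.
by rewrite -ltnS.
Qed.

Lemma ncsubst1 : ncsubst F 1 = 1.
Proof.
rewrite ncsubst_rec scale1r big1 ?addr0 // => c _.
have -> : ncshift c (1 : ncseries G) = 0 by apply/funext.
by rewrite ncsubst0 mulr0.
Qed.

Lemma ncsubst_gen c : ncsubst F (ncword [:: c]) = F c.
Proof.
rewrite ncsubst_rec scale0r add0r (bigD1 c) //= big1 ?addr0 => [|c' nc].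
  have -> : ncshift c (ncword [:: c]) = 1.
    by apply/funext => w; rewrite /ncshift /ncword eqseq_cons eqxx; case: w.
  by rewrite ncsubst1 mulr1.
have -> : ncshift c' (ncword [:: c]) = 0.
  by apply/funext => w; rewrite /ncshift /ncword eqseq_cons (negPf nc).
by rewrite ncsubst0 mulr0.
Qed.

Lemma ncshiftM c f g : ncshift c (f * g) = f [::] *: ncshift c g + ncshift c f * g.
Proof. by apply/funext => w; rewrite /ncshift [LHS]ncmul_cons. Qed.

(** Induction on the precision: once the first letter [c] of [f] is split off, the factor [F c] has
    positive degree and raises the precision of the induction hypothesis by one. *)
Lemma ncsubstM f g : ncsubst F (f * g) = ncsubst F f * ncsubst F g.
Proof.
apply: ncser_eq => N; elim: N f g => [|N IH] f g; first exact: ncvalge0.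
rewrite ncsubst_rec [ncsubst F f]ncsubst_rec mulrDl -scalerAl mul1r.
rewrite {1}[ncsubst F g]ncsubst_rec scalerDr -[in X in _ - X]addrA scalerA.
have -> : (f * g) [::] = f [::] * g [::] by exact: ncmul_nil.
apply: (subspaceBD sV); first by rewrite subrr; exact: (subspace0 sV).
rewrite scaler_sumr mulr_suml -big_split /=; apply: (subspaceB_sum sV) => c _.
rewrite ncshiftM ncsubst_linear mulrDr -scalerAr.
apply: (subspaceBD sV); first by rewrite subrr; exact: (subspace0 sV).
by rewrite -mulrA -mulrBr -add1n; exact: ncvalgeM.
Qed.

End Substitution.

Lemma strands_size n s : strands n s -> (size s <= n)%N.
Proof.
move=> /andP[us /allP hs]; rewrite -(size_iota 1 n); apply: uniq_leq_size => // i /hs.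
by rewrite mem_iota add1n ltnS.
Qed.

Lemma strands2P n i j : strands n [:: i; j] ->
  [/\ (0 < i)%N, (0 < j)%N, (i <= n)%N, (j <= n)%N & i != j].
Proof.
by rewrite /strands /= inE andbT => /and3P[ij /andP[-> ->] /andP[/andP[-> ->] _]].
Qed.

Lemma strands_cat n s1 s2 : strands n (s1 ++ s2) -> strands n s1 /\ strands n s2.
Proof.
by rewrite /strands cat_uniq all_cat => /andP[/and3P[-> _ ->] /andP[-> ->]].
Qed.

Lemma strands3P n i j k : strands n [:: i; j; k] ->
  [/\ strands n [:: i; j], strands n [:: j; k] & strands n [:: i; k]].
Proof.
rewrite /strands /= !inE negb_or !andbT.
move=> /andP[/andP[/andP[ij ik] jk] /and3P[hi hj hk]].
by rewrite ij ik jk hi hj hk.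
Qed.

Lemma tserC n i j : tser n i j = tser n j i.
Proof. by apply/funext => -[|c []] //=; rewrite orbC. Qed.

Lemma tC n i j : t i j = t j i :> Ahat n.
Proof. by rewrite /t tserC. Qed.

Lemma chord_ends_inj n : injective (@chord_ends n).
Proof.
move=> c d; rewrite /chord_ends => -[e1 e2]; apply/val_inj.
by rewrite [LHS]surjective_pairing [RHS]surjective_pairing; congr pair; apply/val_inj.
Qed.

Lemma chordP n (c : chord n) :
  [/\ strands n [:: (chord_ends c).1; (chord_ends c).2],
      ((chord_ends c).1 < (chord_ends c).2)%N &
      tser n (chord_ends c).1 (chord_ends c).2 = ncword [:: c]].
Proof.
have lt d : ((@chord_ends n d).1 < (chord_ends d).2)%N by have /andP[] := valP d.
have c0 : (0 < (chord_ends c).1)%N by have /andP[] := valP c.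
split=> //.
  have c1 : ((chord_ends c).1 <= n)%N by rewrite -ltnS ltn_ord.
  have c2 : ((chord_ends c).2 <= n)%N by rewrite -ltnS ltn_ord.
  move: c0 c1 c2 (lt c); set i := _.1; set j := _.2 => i0 iN jN ij.
  by rewrite /strands /= inE ltn_eqF // i0 iN jN (leq_trans i0 (ltnW ij)).
apply/funext => -[//|d [|d' w]]; last by rewrite /ncword eqseq_cons andbF.
rewrite /ncword eqseq_cons andbT -[LHS]/((_ || _)%:R) -surjective_pairing.
rewrite (inj_eq (@chord_ends_inj n)) [X in _ || X](_ : _ = false) ?orbF //.
by apply/eqP => e; have := lt d; rewrite e ltnNge ltnW // lt.
Qed.

Lemma tser_lt n i j : strands n [:: i; j] -> (i < j)%N ->
  exists2 c : chord n, tser n i j = ncword [:: c] & chord_ends c = (i, j).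
Proof.
move=> /strands2P[i0 j0 iN jN _] ij.
pose p : 'I_n.+1 * 'I_n.+1 := (inord i, inord j).
have hp : (0 < p.1)%N && (p.1 < p.2)%N by rewrite /= !inordK ?ltnS // i0.
pose c : chord n := exist _ p hp.
have ec : chord_ends c = (i, j) by rewrite /chord_ends /= !inordK.
by exists c => //; have [_ _] := chordP c; rewrite ec.
Qed.

Section AlgMap.
Variables (n m : nat) (F : nat -> nat -> Ahat m).
Implicit Types (x y : Ahat n) (f g : ncseries (chord n)).

(** [alg_map] reads [F i j] only for i < j, whereas the relations range over all orders of the
    strands. *)
Definition sym_gen i j : Ahat m := if (i < j)%N then F i j else F j i.

Hypothesis F1 : forall i j, strands n [:: i; j] -> deg_ge 1 (sym_gen i j).
Hypothesis F4T : forall i j k, strands n [:: i; j; k] ->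
  bracket (sym_gen i j + sym_gen j k) (sym_gen i k) = 0.
Hypothesis Fcomm : forall i j k l, strands n [:: i; j; k; l] ->
  bracket (sym_gen i j) (sym_gen k l) = 0.

Local Notation Fgen :=
  (fun c : chord n => Arep (F (chord_ends c).1 (chord_ends c).2)).

Lemma Fgen1 c : ncvalge 1 (Fgen c).
Proof.
have [hs lt _] := chordP c; apply/ncvalge1P/deg_ge1_Arep.
by have := F1 hs; rewrite /sym_gen lt.
Qed.

Definition ncsubst_Api f : Ahat m := Api (ncsubst Fgen f).

Lemma ncsubst_Api_tser i j : strands n [:: i; j] ->
  ncsubst_Api (tser n i j) = sym_gen i j.
Proof.
move=> hs; wlog ij : i j hs / (i < j)%N => [H|].
  have [ij|ji] := ltnP i j; first exact: H.
  have [i0 j0 iN jN nij] := strands2P hs.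
  have ltji : (j < i)%N by rewrite ltn_neqAle eq_sym nij.
  rewrite tserC H //; first by rewrite /sym_gen ltji ltnNge ltnW.
  by rewrite /strands /= inE eq_sym nij i0 j0 iN jN.
have [c -> ec] := tser_lt hs ij.
by rewrite /ncsubst_Api (ncsubst_gen Fgen1) ec ArepK /sym_gen ij.
Qed.

Lemma ncsubst_Api_linear a f g :
  ncsubst_Api (a *: f + g) = a *: ncsubst_Api f + ncsubst_Api g.
Proof. by rewrite /ncsubst_Api ncsubst_linear linearP. Qed.

Lemma ncsubst_ApiM f g : ncsubst_Api (f * g) = ncsubst_Api f * ncsubst_Api g.
Proof. by rewrite /ncsubst_Api (ncsubstM Fgen1) rmorphM. Qed.

Lemma ncsubst_Api_bracket f g :
  ncsubst_Api (bracket f g) = bracket (ncsubst_Api f) (ncsubst_Api g).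
Proof.
rewrite /bracket addrC -scaleN1r ncsubst_Api_linear !ncsubst_ApiM.
by rewrite scaleN1r addrC.
Qed.

Lemma ncsubst_ApiD f g : ncsubst_Api (f + g) = ncsubst_Api f + ncsubst_Api g.
Proof. by rewrite -[f]scale1r ncsubst_Api_linear !scale1r. Qed.

(** The kernel is a two-sided ideal containing the relators. It is closed because substitution does
    not lower degrees and the target is separated. *)
Lemma ncsubst_Api_relset f : relset n f -> ncsubst_Api f = 0.
Proof.
move=> hf; apply: (hf [set f | ncsubst_Api f = 0]); split; last first.
  move=> r [[i [j [k [hs ->]]]]|[i [j [k [l [hs ->]]]]]] /=;
    rewrite ncsubst_Api_bracket ?ncsubst_ApiD.
    by have [hij hjk hik] := strands3P hs; rewrite !ncsubst_Api_tser // F4T.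
  have [hij hkl] := strands_cat (hs : strands n ([:: i; j] ++ [:: k; l])).
  by rewrite !ncsubst_Api_tser // Fcomm.
split; first split; first split.
- by rewrite /= /ncsubst_Api ncsubst0 raddf0.
- by move=> a x y /= hx hy; rewrite ncsubst_Api_linear hx hy scaler0 addr0.
- by move=> a x /= hx; rewrite !ncsubst_ApiM hx mulr0 mul0r.
- move=> x hx; apply: Ahat_sep => N; have [y hy xy] := hx N.
  rewrite -[x](subrK y) ncsubst_ApiD hy addr0.
  exact/deg_ge_Api/ncsubst_valge.
Qed.

Lemma alg_map_Api f : alg_map F (Api f) = ncsubst_Api f.
Proof.
apply/eqP; rewrite -subr_eq0 /alg_map -/(ncsubst_Api _) -scaleN1r addrC.
by rewrite -ncsubst_Api_linear scaleN1r addrC ncsubst_Api_relset //; exact: Arep_pi.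
Qed.

Lemma alg_map_linear a x y : alg_map F (a *: x + y) = a *: alg_map F x + alg_map F y.
Proof.
by rewrite -(ArepK x) -(ArepK y) -linearP !alg_map_Api ncsubst_Api_linear.
Qed.

Lemma alg_mapM x y : alg_map F (x * y) = alg_map F x * alg_map F y.
Proof.
by rewrite -(ArepK x) -(ArepK y) -rmorphM !alg_map_Api ncsubst_ApiM.
Qed.

Lemma alg_map1 : alg_map F (1 : Ahat n) = 1.
Proof.
by rewrite -(rmorph1 (@Api n)) alg_map_Api /ncsubst_Api (ncsubst1 Fgen1) rmorph1.
Qed.

Lemma alg_map_t i j : strands n [:: i; j] -> alg_map F (t i j : Ahat n) = sym_gen i j.
Proof. by move=> hs; rewrite /t alg_map_Api ncsubst_Api_tser. Qed.

Lemma alg_map_deg_ge N x : deg_ge N x -> deg_ge N (alg_map F x).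
Proof. by move=> [f hf ->]; rewrite alg_map_Api; exact/deg_ge_Api/ncsubst_valge. Qed.

Lemma alg_map0 : alg_map F (0 : Ahat n) = 0.
Proof. by rewrite -(raddf0 (@Api n)) alg_map_Api /ncsubst_Api ncsubst0 raddf0. Qed.

Lemma alg_mapB x y : alg_map F (x - y) = alg_map F x - alg_map F y.
Proof. by rewrite addrC -scaleN1r alg_map_linear scaleN1r addrC. Qed.

Lemma alg_mapX x k : alg_map F (x ^+ k) = alg_map F x ^+ k.
Proof. by elim: k => [|k IH]; rewrite ?alg_map1 // !exprS alg_mapM IH. Qed.

Lemma alg_map_expA x : deg_ge 1 x -> alg_map F (expA x) = expA (alg_map F x).
Proof.
move=> hx; apply: Ahat_eq => N.
have sF := @subspace_deg_ge m N; set c := fun k => (k`!)%:R^-1 : rat.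
have h1 := alg_map_deg_ge (power_sumP c N hx); rewrite alg_mapB in h1.
apply: (subspaceBt sF) h1 _; apply: (subspaceBC sF).
have := power_sumP c N (alg_map_deg_ge hx); congr (deg_ge N (_ - _)).
elim/big_rec2: _ => [|k y z _ ->]; first by rewrite alg_map0.
by rewrite alg_map_linear alg_mapX.
Qed.

Lemma alg_map_Lhat x : (forall i j, strands n [:: i; j] -> Lhat (sym_gen i j)) ->
  Lhat x -> Lhat (alg_map F x).
Proof.
move=> hL; have sL := @subspace_Lhat m.
suff h : @Lhat n `<=` [set x | Lhat (alg_map F x)] by exact: h.
apply: Lhat_ind => [||i j hij] /=; last by rewrite alg_map_t //; exact: hL.
  split; first split.
  - by rewrite /= alg_map0; exact: (subspace0 sL).
  - by move=> a y z /= hy hz; rewrite alg_map_linear; apply: sL.2.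
  - move=> y z hy hz; rewrite /= /bracket alg_mapB !alg_mapM.
    exact: Lhat_bracket.
move=> y hy; apply: Lhat_fclosed => N; have [z hz yz] := hy N.
by exists (alg_map F z) => //; rewrite -alg_mapB; exact: alg_map_deg_ge.
Qed.

Lemma alg_map_grouplike x :
  (forall i j, strands n [:: i; j] -> Lhat (sym_gen i j)) ->
  grouplike x -> grouplike (alg_map F x).
Proof.
move=> hL [a ha ->]; exists (alg_map F a); first exact: alg_map_Lhat.
by rewrite alg_map_expA //; exact: Lhat_deg_ge1.
Qed.

End AlgMap.

(** * Lie elements of 1FF *)

Section Metabelian.
(* [gen] is a variable only to keep unification from unfolding the quotient. *)
Variables (n : nat) (gen : chord n -> Ahat n).
Hypothesis genE : forall c, gen c = Api (ncword [:: c]).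
Implicit Types (x y z e p q : Ahat n) (f g : ncseries (chord n)).
Implicit Types (a b c : chord n) (r u v w : seq (chord n)).
Local Notation sL := (@subspace_Lhat n).
Local Notation sF := (@subspace_deg_ge n _).

Lemma LLLL_lie_ideal : lie_ideal (@Lhat n) (@LLLL n).
Proof.
split.
- move=> x; apply; split; last first.
    move=> _ [a [b [c [d [[ha hb hc hd] ->]]]]].
    by apply: Lhat_bracket; exact: Lhat_bracket.
  split; last exact: Lhat_fclosed.
  by split=> //; [exact: sL | move=> l y hl hy; exact: Lhat_bracket].
- split; first by move=> I [[[_ [I0 _] _] _] _].
  move=> a x y hx hy I hI; have [_ [_ h] _] := hI.1.1.
  by apply: h; [exact: hx | exact: hy].
- move=> l x hl hx I hI; have [_ _ h] := hI.1.1.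
  by apply: h => //; exact: hx.
Qed.

Lemma subspace_LLLL : subspace (@LLLL n). Proof. by have [_ h _] := LLLL_lie_ideal. Qed.
Local Notation sM := subspace_LLLL.

Lemma LLLL_bracketr x e : Lhat e -> LLLL x -> LLLL (bracket x e).
Proof.
have [_ _ h] := LLLL_lie_ideal; move=> he hx.
by rewrite bracketC; exact: (subspaceN sM (h _ _ he hx)).
Qed.

Lemma LLLL_fclosed : fclosed (@deg_ge n) (@LLLL n).
Proof.
move=> x hx I hI; apply: hI.1.2 => N.
by have [y hy xy] := hx N; exists y => //; exact: hy.
Qed.

(** Single brackets, not their span: [adr] preserves this form, and the bracket of two such elements
    is a generator of [LLLL]. *)
Definition derived x := exists p q, [/\ Lhat p, Lhat q & x = bracket p q].

Lemma derived_bracket x y : derived x -> derived y -> LLLL (bracket x y).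
Proof.
move=> [p [q [hp hq ->]]] [p' [q' [hp' hq' ->]]] I hI; apply: hI.2.
by exists p, q, p', q'; split.
Qed.

Lemma t_gen i j : strands n [:: i; j] -> exists c, t i j = gen c.
Proof.
move=> hs; have [i0 j0 iN jN nij] := strands2P hs.
have [ij|ji] := ltnP i j.
  by have [c ec _] := tser_lt hs ij; exists c; rewrite /t ec genE.
have hs' : strands n [:: j; i] by rewrite /strands /= inE eq_sym nij i0 j0 iN jN.
have lt : (j < i)%N by rewrite ltn_neqAle eq_sym nij.
by have [c ec _] := tser_lt hs' lt; exists c; rewrite tC /t ec genE.
Qed.

Lemma Lhat_gen c : Lhat (gen c).
Proof.
have [hs _ e] := chordP c; have := Lhat_t hs.
by rewrite /t e genE.
Qed.

(* The word [r] acting on [z] by right brackets, last letter first. *)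
Fixpoint adr z r : Ahat n := if r is c :: r' then bracket (adr z r') (gen c) else z.

(* The sum over the letters c of r of [x, c] acted on by the other letters. *)
Fixpoint adsum x r : Ahat n :=
  if r is c :: r' then bracket (adsum x r') (gen c) + adr (bracket x (gen c)) r'
  else 0.

(** The list is reversed because [adr] and [adsum] let its last entry act first. A single letter
    needs its own case, since [adsum] over no letters is 0. *)
Definition retract v : Ahat n :=
  match v with
  | [::] => 0
  | [:: c] => gen c
  | c :: w => (size v)%:R^-1 *: adsum (gen c) (rev w)
  end.

Lemma Lhat_adr z r : Lhat z -> Lhat (adr z r).
Proof.
by move=> hz; elim: r => //= c r IH; apply: Lhat_bracket => //; exact: Lhat_gen.
Qed.

Lemma Lhat_adsum x r : Lhat x -> Lhat (adsum x r).
Proof.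
move=> hx; elim: r => [|c r IH] /=; first exact: (subspace0 sL).
apply: (subspaceD sL); first by apply: Lhat_bracket => //; exact: Lhat_gen.
by apply: Lhat_adr; apply: Lhat_bracket => //; exact: Lhat_gen.
Qed.

Lemma adr_cat z r1 r2 : adr z (r1 ++ r2) = adr (adr z r2) r1.
Proof. by elim: r1 => //= c r1 ->. Qed.

Lemma adr_linear k y z r : adr (k *: y + z) r = k *: adr y r + adr z r.
Proof. by elim: r => //= c r ->; rewrite bracketDl bracketZl. Qed.

Lemma adrB y z r : adr (y - z) r = adr y r - adr z r.
Proof. by elim: r => //= c r ->; rewrite bracketBl. Qed.

Lemma adr0 r : adr 0 r = 0.
Proof. by elim: r => //= c r ->; rewrite bracket0l. Qed.

Lemma LLLL_adr z r : LLLL z -> LLLL (adr z r).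
Proof. by move=> hz; elim: r => //= c r; apply: LLLL_bracketr; exact: Lhat_gen. Qed.

Lemma bracket_swap x y z :
  bracket (bracket x y) z - bracket (bracket x z) y = bracket x (bracket y z).
Proof.
have -> : bracket (bracket x y) z = bracket (bracket x z) y + bracket x (bracket y z).
  exact: bracket_jacobi.
by rewrite addrAC subrr add0r.
Qed.

Lemma bracket_swapD s x y p q :
  bracket (bracket s x + p) y + bracket q x
    - (bracket (bracket s y + q) x + bracket p y) = bracket s (bracket x y).
Proof.
rewrite (bracketDl (bracket s x)) (bracketDl (bracket s y)).
rewrite -[X in X - _]addrA -[X in _ - X]addrA.
by rewrite [bracket q x + _]addrC opprD addrACA subrr addr0 bracket_swap.
Qed.

Lemma derived_adr z r : derived z -> derived (adr z r).
Proof.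
case: r => //= c r [p [q [hp hq ->]]]; exists (adr (bracket p q) r), (gen c).
by split=> //; [by apply: Lhat_adr; exact: Lhat_bracket | exact: Lhat_gen].
Qed.

(** By Jacobi the difference is the bracket of [adr z r] with [b, a], both of which lie in
    [L, L]. *)
Lemma adr_swap z a b r : derived z -> LLLL (adr z (a :: b :: r) - adr z (b :: a :: r)).
Proof.
move=> hz /=; have hw := derived_adr r hz; set w := adr z r in hw *.
have -> : bracket (bracket w (gen b)) (gen a) - bracket (bracket w (gen a)) (gen b)
    = bracket w (bracket (gen b) (gen a)).
  exact: bracket_swap.

apply: derived_bracket => //.
by exists (gen b), (gen a); split=> //; exact: Lhat_gen.
Qed.

Lemma adr_swap_in z r2 a b r1 : derived z ->
  LLLL (adr z (r2 ++ a :: b :: r1) - adr z (r2 ++ b :: a :: r1)).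
Proof. by move=> hz; rewrite !adr_cat -adrB; apply: LLLL_adr; exact: adr_swap. Qed.

Lemma adr_rcons z r c : derived z -> LLLL (adr z (r ++ [:: c]) - adr z (c :: r)).
Proof.
move=> hz; elim: r => [|a r IH]; first by rewrite subrr; exact: (subspace0 sM).
apply: (subspaceBt sM) (adr_swap a c r hz).
by rewrite /= -bracketBl; apply: LLLL_bracketr => //; exact: Lhat_gen.
Qed.

Lemma adsum_swap x r2 a b r1 : Lhat x ->
  LLLL (adsum x (r2 ++ a :: b :: r1) - adsum x (r2 ++ b :: a :: r1)).
Proof.
move=> hx; elim: r2 => [|c r2 IH] /=; last first.
  apply: (subspaceBD sM).
    by rewrite -bracketBl; apply: LLLL_bracketr => //; exact: Lhat_gen.
  apply: adr_swap_in; exists x, (gen c); split=> //; exact: Lhat_gen.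
(* The terms where [x] meets [a] or [b] cancel in pairs; only the bracket of [adsum x r1] with
   [b, a] remains. *)
rewrite bracket_swapD.
have hba : derived (bracket (gen b) (gen a)).
  by exists (gen b), (gen a); split=> //; exact: Lhat_gen.
(* Over no letters the sum is 0. Otherwise both summands of [adsum x (c :: r1)] are in [L, L], so
   their brackets with [b, a] are in [LLLL]. *)
case: r1 => [|c r1] /=; first by rewrite bracket0l; exact: (subspace0 sM).
rewrite (bracketDl (bracket (adsum x r1) (gen c))).
have hS : derived (bracket (adsum x r1) (gen c)).
  exists (adsum x r1), (gen c); split; [exact: Lhat_adsum|exact: Lhat_gen|by []].
have hu : derived (adr (bracket x (gen c)) r1).
  apply: derived_adr; exists x, (gen c); split; [exact: hx|exact: Lhat_gen|by []].
exact: (subspaceD sM (derived_bracket hS hba) (derived_bracket hu hba)).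
Qed.

Lemma adsum_antisym a b r :
  LLLL (adsum (gen a) (r ++ [:: b]) - adsum (gen b) (r ++ [:: a])
        - (size r).+2%:R *: adr (bracket (gen a) (gen b)) r).
Proof.
have hab c d : derived (bracket (gen c) (gen d)).
  by exists (gen c), (gen d); split=> //; exact: Lhat_gen.
elim: r => [|c r IH] /=.
  rewrite (bracket0l (gen a)) (bracket0l (gen b)) !add0r.
  rewrite (bracketC (gen a) (gen b)) opprK -mulr2n -scaler_nat subrr.
  exact: (subspace0 sM).
set S := adsum (gen a) _; set S' := adsum (gen b) _.
set z := bracket (gen a) (gen b); set A := adr _ (r ++ _); set A' := adr _ (r ++ _).
(* Jacobi in the form [[a, c], b] - [[b, c], a] = [[a, b], c]: every further letter [c] contributes
   one more copy. *)
have eA : A - A' = adr (bracket z (gen c)) r.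
  rewrite /A /A' !adr_cat -adrB /= /z (bracket_jacobi (gen a) (gen b)).
  by rewrite [bracket (gen a) (bracket _ _)]bracketC.
have h : LLLL (A - A' - adr z (c :: r)).
  by rewrite eA -[bracket z _]/(adr z [:: c]) -adr_cat; apply: adr_rcons; exact: hab.
have h' := LLLL_bracketr (Lhat_gen c) IH.
have := subspaceD sM h' h; congr (@LLLL n _).
rewrite !bracketBl bracketZl -/S -/S' -/z /=; set B := bracket (adr z r) _.
have -> : (size r).+3%:R *: B = (size r).+2%:R *: B + B.
  by rewrite -(natr1 (size r).+2) scalerDl scale1r.
by rewrite addrACA [_ - _ + (_ - _)]addrACA -!opprD.
Qed.

Lemma retractE c w : w != [::] ->
  retract (c :: w) = (size w).+1%:R^-1 *: adsum (gen c) (rev w).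
Proof. by case: w. Qed.

Lemma retract_swap c u a b v :
  LLLL (retract (c :: u ++ a :: b :: v) - retract (c :: u ++ b :: a :: v)).
Proof.
have nz a' b' : u ++ a' :: b' :: v != [::] by case: u.
rewrite !retractE // !size_cat -scalerBr; apply: (subspaceZ sM).
rewrite !rev_cat !rev_cons -!cats1 -!catA /=.
exact: adsum_swap (Lhat_gen c).
Qed.

Lemma retract_move c u a (p : seq (chord n)) v :
  LLLL (retract (c :: u ++ a :: p ++ v) - retract (c :: u ++ p ++ a :: v)).
Proof.
elim: p u => [|b p IH] u /=; first by rewrite subrr; exact: (subspace0 sM).
apply: (subspaceBt sM) (retract_swap c u a b (p ++ v)) _.
by have := IH (rcons u b); rewrite !cat_rcons.
Qed.

(** The symmetry in all letters but the first, in the form that applies to a factor xy - yx preceded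
    by at least one letter. *)
Lemma retract_swap_words c u (p q : seq (chord n)) v :
  LLLL (retract (c :: u ++ p ++ q ++ v) - retract (c :: u ++ q ++ p ++ v)).
Proof.
elim: p u => [|a p IH] u /=; first by rewrite subrr; exact: (subspace0 sM).
have h := IH (rcons u a); rewrite !cat_rcons in h.
exact: (subspaceBt sM) h (retract_move c u a q (p ++ v)).
Qed.

(** The division by the length in [retract] is chosen for this: it cancels the factor in
    [adsum_antisym]. *)
Lemma retract_antisym a b w :
  LLLL (retract (a :: b :: w) - retract (b :: a :: w)
        - adr (bracket (gen a) (gen b)) (rev w)).
Proof.
rewrite !retractE //= !rev_cons -!cats1.
have := adsum_antisym a b (rev w); rewrite size_rev; set k : rat := _%:R => h.
have := subspaceZ sM k^-1 h; rewrite (scalerBr k^-1 (_ - _)) scalerA mulVf.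
  by rewrite scale1r (scalerBr k^-1 (adsum _ _)).
by rewrite Num.Theory.pnatr_eq0.
Qed.

Lemma deg_ge_gen c : deg_ge 1 (gen c).
Proof. by rewrite genE; apply: deg_ge_Api; exact: (@ncvalge_word _ [:: c]). Qed.

Lemma deg_ge_adr M z r : deg_ge M z -> deg_ge (M + size r) (adr z r).
Proof.
move=> hz; elim: r => [|c r IH] /=; first by rewrite addn0.
by rewrite addnS -addn1; apply: deg_ge_bracket => //; exact: deg_ge_gen.
Qed.

Lemma deg_ge_adsum x r : deg_ge 1 x -> deg_ge (size r).+1 (adsum x r).
Proof.
move=> hx; elim: r => [|c r IH] /=; first exact: (subspace0 sF).
apply: (subspaceD sF).
  by rewrite -addn1; apply: deg_ge_bracket => //; exact: deg_ge_gen.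
rewrite -[(size r).+2]add2n; apply: deg_ge_adr.
exact: deg_ge_bracket hx (deg_ge_gen c).
Qed.

Lemma deg_ge_retract v : deg_ge (size v) (retract v).
Proof.
case: v => [|c w]; first exact: deg_ge0.
have [->|nw] := eqVneq w [::]; first exact: deg_ge_gen.
rewrite retractE //; apply: (subspaceZ sF) => /=.
by rewrite -(size_rev w); apply: deg_ge_adsum; exact: deg_ge_gen.
Qed.

(** * The retraction on series and on the quotient, modulo degree [N] *)

Definition LLLL_deg N x := exists2 y, LLLL y & deg_ge N (x - y).

Variable N : nat.
Local Notation Q := (LLLL_deg N).

Lemma LLLL_deg_LLLL x : LLLL x -> Q x.
Proof. by exists x; rewrite ?subrr //; exact: (subspace0 sF). Qed.

Lemma LLLL_deg_deg x : deg_ge N x -> Q x.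
Proof. by exists 0; rewrite ?subr0 //; exact: (subspace0 sM). Qed.

Lemma subspace_LLLL_deg : subspace Q.
Proof.
split; first by apply: LLLL_deg_LLLL; exact: (subspace0 sM).
move=> k x y [x' hx' xx'] [y' hy' yy']; exists (k *: x' + y'); first exact: sM.2.
by apply: (subspaceBD sF) => //; exact: (subspaceBZ sF).
Qed.
Local Notation sQ := subspace_LLLL_deg.

Lemma LLLL_deg_bracket x e : Lhat e -> Q x -> Q (bracket x e).
Proof.
move=> he [y hy xy]; exists (bracket y e); first exact: LLLL_bracketr.
rewrite -bracketBl; have := deg_ge_bracket xy (Lhat_deg_ge1 he).
by apply: deg_ge_le; rewrite addn1.
Qed.

(** Words of length at least [N] are dropped to keep the sum finite; [retract] would send them into
    degree [N], which is neglected. *)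
Definition series_retract f : Ahat n :=
  \sum_(k < N) \sum_(v : k.-tuple (chord n)) f v *: retract v.
Local Notation TH := series_retract.

Lemma series_retract_linear k f g : TH (k *: f + g) = k *: TH f + TH g.
Proof.
rewrite /TH scaler_sumr -big_split; apply: eq_bigr => i _ /=.
rewrite scaler_sumr -big_split; apply: eq_bigr => v _ /=.
by rewrite ncserD ncserZ scalerDl scalerA.
Qed.

Lemma series_retractB f g : TH (f - g) = TH f - TH g.
Proof. by rewrite addrC -scaleN1r series_retract_linear scaleN1r addrC. Qed.

Lemma series_retract_valge f : ncvalge N f -> TH f = 0.
Proof.
move=> hf; rewrite /TH big1 // => i _; rewrite big1 // => v _.
by rewrite hf ?scale0r // size_tuple.
Qed.

Lemma series_retract_word v : Q (TH (ncword v) - retract v).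
Proof.
apply: LLLL_deg_deg; have [lv|lv] := ltnP (size v) N; last first.
  rewrite series_retract_valge ?sub0r; last first.
    exact: ncvalge_le lv _ (@ncvalge_word _ v).
  by apply: (subspaceN sF); exact: deg_ge_le lv (deg_ge_retract v).
suff -> : TH (ncword v) = retract v by rewrite subrr; exact: (subspace0 sF).
rewrite /TH (bigD1 (Ordinal lv)) //= (bigD1 (in_tuple v)) //=.
rewrite /ncword eqxx scale1r big1 ?addr0 => [|w nw]; last first.
  have wv : tval w != v by apply: contraNneq nw => wv; apply/eqP/val_inj.
  by rewrite (negPf wv) scale0r.
rewrite big1 ?addr0 // => k nk; rewrite big1 // => w _.
have wv : tval w != v.
  by apply: contraNneq nk => wv; apply/eqP/val_inj; rewrite /= -wv size_tuple.
by rewrite (negPf wv) scale0r.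
Qed.

Lemma LLLL_deg_span (T : ncseries (chord n) -> Ahat n) f :
  (forall k g h, T (k *: g + h) = k *: T g + T h) ->
  (forall g, ncvalge N g -> Q (T g)) ->
  (forall v, f v != 0 -> Q (T (ncword v))) -> Q (T f).
Proof.
move=> linT contT; apply: (@ncword_span _ N [set g | Q (T g)]) => //.
split; last by move=> k g h /= hg hh; rewrite linT; exact: sQ.2.
by apply: contT => w.
Qed.

(** Linearity in each of the four factors reduces them to words. As [f] has no constant term, its
    words are nonempty and the exchange leaves the first letter in place. *)
Lemma series_retract_swap f g h k :
  f [::] = 0 -> Q (TH (f * bracket g h * k)).
Proof.
move=> f0; pose T f g h k := TH (f * bracket g h * k); rewrite -/(T f g h k).
have vV g' : ncvalge N g' -> Q (TH g').
  by move=> /series_retract_valge ->; exact: (subspace0 sQ).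
have vB g' h' : ncvalge N g' -> ncvalge N (bracket g' h').
  by move=> hg; apply: (subspaceB (subspace_ncvalge _ _));
    [exact: ncvalgeMr | exact: ncvalgeMl].
apply: (@LLLL_deg_span (fun f => T f g h k)) => [a f1 f2|f1 hf1|[|c u] fu].
- by rewrite /T !mulrDl -!scalerAl series_retract_linear.
- by apply: vV; do 2!apply: ncvalgeMr.
- by rewrite f0 eqxx in fu.
apply: (@LLLL_deg_span (fun g => T _ g h k)) => [a f1 f2|f1 hf1|p _].
- rewrite /T bracketDl bracketZl mulrDr mulrDl -scalerAr -scalerAl.
  exact: series_retract_linear.
- by apply: vV; apply: ncvalgeMr; apply: ncvalgeMl; exact: vB.
apply: (@LLLL_deg_span (fun h => T _ _ h k)) => [a f1 f2|f1 hf1|q _].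
- rewrite /T bracketDr bracketZr mulrDr mulrDl -scalerAr -scalerAl.
  exact: series_retract_linear.
- apply: vV; apply: ncvalgeMr; apply: ncvalgeMl; rewrite bracketC.
  by apply: (subspaceN (subspace_ncvalge _ _)); exact: vB.
apply: (@LLLL_deg_span (fun k => T _ _ _ k)) => [a f1 f2|f1 hf1|v _].
- by rewrite /T mulrDr -scalerAr series_retract_linear.
- by apply: vV; exact: ncvalgeMl.
rewrite /T /bracket mulrBr mulrBl !ncwordM series_retractB -!catA.
have h1 := series_retract_word ((c :: u) ++ p ++ q ++ v).
have h2 := series_retract_word ((c :: u) ++ q ++ p ++ v).
apply: (subspaceB_in sQ (subspaceBB sQ h1 h2)).
apply: LLLL_deg_LLLL; exact: retract_swap_words.
Qed.

Definition linear_series f := forall w, size w != 1%N -> f w = 0.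

Lemma linear_series_word f w : linear_series f -> f w != 0 -> exists c, w = [:: c].
Proof.
move=> hf; case: w => [|c [|d w]]; last by rewrite hf ?eqxx.
  by rewrite hf ?eqxx.
by exists c.
Qed.

Lemma deg_ge_adr0 M z r : deg_ge M z -> deg_ge M (adr z r).
Proof. by move=> /(deg_ge_adr r); apply: deg_ge_le; rewrite leq_addr. Qed.

Lemma deg_ge_bracketl M y z : deg_ge M y -> deg_ge M (bracket y z).
Proof. by move=> hy; rewrite -[M]addn0; apply: deg_ge_bracket => //; exact: deg_ge0. Qed.

Lemma bracket_ncword a b v :
  bracket (ncword [:: a]) (ncword [:: b]) * ncword v =
    ncword [:: a, b & v] - ncword [:: b, a & v].
Proof.
rewrite (_ : bracket _ _ = ncword [:: a; b] - ncword [:: b; a]).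
  rewrite mulrBl; congr (_ - _); first exact: (ncwordM [:: a; b]).
  exact: (ncwordM [:: b; a]).
rewrite /bracket; congr (_ - _); first exact: (ncwordM [:: a]).
exact: (ncwordM [:: b]).
Qed.

(** At the start of a word a bracket of linear series becomes its own value in the algebra, acted on
    by the remaining letters. This both kills the relators, whose value is 0, and fixes the brackets
    of two generators. *)
Lemma series_retract_bracket f g v : linear_series f -> linear_series g ->
  Q (TH (bracket f g * ncword v) - adr (bracket (Api f) (Api g)) (rev v)).
Proof.
move=> hf hg.
pose T f g := TH (bracket f g * ncword v) - adr (bracket (Api f) (Api g)) (rev v).
rewrite -/(T f g).
have vB g' h' : ncvalge N g' -> Q (T g' h').
  move=> hg'; rewrite /T series_retract_valge ?sub0r.
    apply: (subspaceN sQ); apply: LLLL_deg_deg; apply: deg_ge_adr0.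
    exact/deg_ge_bracketl/deg_ge_Api.
  apply: ncvalgeMr; apply: (subspaceB (subspace_ncvalge _ _));
    [exact: ncvalgeMr | exact: ncvalgeMl].
have lT k f1 f2 g' : T (k *: f1 + f2) g' = k *: T f1 g' + T f2 g'.
  rewrite /T bracketDl bracketZl mulrDl -scalerAl series_retract_linear.
  by rewrite linearP bracketDl bracketZl adr_linear scalerBr opprD addrACA.
have rT k f' g1 g2 : T f' (k *: g1 + g2) = k *: T f' g1 + T f' g2.
  rewrite /T bracketDr bracketZr mulrDl -scalerAl series_retract_linear.
  by rewrite linearP bracketDr bracketZr adr_linear scalerBr opprD addrACA.
have rB g' h' : ncvalge N h' -> Q (T g' h').
  move=> hh'; rewrite /T series_retract_valge ?sub0r.
    apply: (subspaceN sQ); apply: LLLL_deg_deg; apply: deg_ge_adr0.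
    by rewrite bracketC; apply: (subspaceN sF); exact/deg_ge_bracketl/deg_ge_Api.
  apply: ncvalgeMr; apply: (subspaceB (subspace_ncvalge _ _));
    [exact: ncvalgeMl | exact: ncvalgeMr].
apply: (@LLLL_deg_span (fun f => T f g)) => // [f1|u]; first exact: vB.
move=> /(linear_series_word hf)[a ->] {u}.
apply: (@LLLL_deg_span (fun g => T _ g)) => // [f1|u]; first exact: rB.
move=> /(linear_series_word hg)[b ->] {u}.
have -> : T (ncword [:: a]) (ncword [:: b]) =
    TH (ncword [:: a, b & v]) - TH (ncword [:: b, a & v])
    - adr (bracket (gen a) (gen b)) (rev v).
  by rewrite (genE a) (genE b) -series_retractB -bracket_ncword.
have h1 := series_retract_word [:: a, b & v].
have h2 := series_retract_word [:: b, a & v].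
apply: (subspaceBt sQ (subspaceBB sQ h1 h2)).
by apply: LLLL_deg_LLLL; exact: retract_antisym.
Qed.

Lemma linear_seriesD f g : linear_series f -> linear_series g -> linear_series (f + g).
Proof. by move=> hf hg w hw; rewrite ncserD hf // hg // addr0. Qed.

Lemma linear_tser i j : linear_series (tser n i j).
Proof. by move=> [|c [|d w]]. Qed.

(** [TH] is not multiplicative, so the closed ideal to compare with consists of the series that are
    killed between any two factors. *)
Lemma series_retract_relset f : relset n f -> Q (TH f).
Proof.
move=> hf; have vV g' : ncvalge N g' -> Q (TH g').
  by move=> /series_retract_valge ->; exact: (subspace0 sQ).
suff h : forall g h, Q (TH (g * f * h)) by have := h 1 1; rewrite mul1r mulr1.
apply: (hf [set f | forall g h, Q (TH (g * f * h))]); split; last first.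
  have br (d e : ncseries (chord n)) :
      linear_series d -> linear_series e -> Api (bracket d e) = 0 ->
      forall g h, Q (TH (g * bracket d e * h)).
    move=> hd he r0 g h.
    apply: (@LLLL_deg_span (fun g => TH (g * bracket d e * h))) => [k f1 f2|f1 hf1|u _].
    - by rewrite !mulrDl -!scalerAl series_retract_linear.
    - by apply: vV; do 2!apply: ncvalgeMr.
    (* Behind a nonempty prefix a relator is killed like any commutator; with no prefix, because its
       value in the algebra is 0. *)
    case: u => [|c u]; last exact: series_retract_swap.
    apply: (@LLLL_deg_span (fun h => TH (_ * bracket d e * h))) => [k f1 f2|f1 hf1|v _].
    - by rewrite mulrDr -!scalerAr series_retract_linear.
    - by apply: vV; exact: ncvalgeMl.
    rewrite ncword_nil mul1r; apply: (subspaceB_in sQ (series_retract_bracket v hd he)).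
    rewrite (_ : bracket (Api d) (Api e) = 0) ?adr0; first exact: (subspace0 sQ).
    by rewrite -r0 Api_bracket.
  move=> r hr; have r0 : Api r = 0.
    rewrite -(raddf0 (@Api n)); apply/Api_eq; rewrite subr0.
    exact: relset_relator.
  case: hr r0 => [[i [j [k [_ ->]]]]|[i [j [k [l [_ ->]]]]]] r0; apply: br => //;
    by [exact: linear_tser | apply: linear_seriesD; exact: linear_tser].
split; first split; first split.
- by move=> g h; rewrite mulr0 mul0r; apply: vV => w.
- move=> k x y /= hx hy g h; rewrite mulrDr mulrDl -scalerAr -scalerAl.
  by rewrite series_retract_linear; apply: sQ.2.
- move=> a x /= hx; split=> g h; first by rewrite mulrA.
  by rewrite -!mulrA mulrA.
- move=> x hx g h; have [y hy xy] := hx N.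
  rewrite -[x](subrK y) mulrDr mulrDl -[_ * (x - y) * h]scale1r series_retract_linear.
  apply: sQ.2; last exact: hy.
  by apply: vV; apply: ncvalgeMr; exact: ncvalgeMl.
Qed.

(** The value for another representative differs by an element of [LLLL_deg N], so linearity holds
    only up to such elements. *)
Definition Aretract x := TH (Arep x).
Local Notation TA := Aretract.

Lemma Aretract_Api f : Q (TA (Api f) - TH f).
Proof. by rewrite -series_retractB; apply: series_retract_relset; exact: Arep_pi. Qed.

Lemma Aretract_linear k x y : Q (TA (k *: x + y) - (k *: TA x + TA y)).
Proof.
rewrite -series_retract_linear -{1}(ArepK x) -{1}(ArepK y) -linearP.
exact: Aretract_Api.
Qed.

Lemma Aretract_deg_ge x : deg_ge N x -> Q (TA x).
Proof.
move=> [f hf ->]; apply: (subspaceB_in sQ (Aretract_Api f)).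
by rewrite series_retract_valge //; exact: (subspace0 sQ).
Qed.

Lemma AretractB x y : Q (TA (x - y) - (TA x - TA y)).
Proof.
have := Aretract_linear (-1) y x.
by rewrite !scaleN1r [- y + x]addrC [- TA y + _]addrC.
Qed.

Lemma Aretract_swap (u x y v : Ahat n) : deg_ge 1 u -> Q (TA (u * bracket x y * v)).
Proof.
move=> [f /ncvalge1P f0 ->]; rewrite -(ArepK x) -(ArepK y) -(ArepK v).
have -> : Api f * bracket (Api (Arep x)) (Api (Arep y)) * Api (Arep v)
    = Api (f * bracket (Arep x) (Arep y) * Arep v).
  by rewrite !rmorphM /= Api_bracket.
apply: (subspaceB_in sQ (Aretract_Api _)).
exact: series_retract_swap.
Qed.

Lemma oneFF_retract x : oneFF x -> Q (TA x).
Proof.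
move=> hx; suff h : forall u v : Ahat n, Q (TA (u * x * v)).
  by have := h 1 1; rewrite mul1r mulr1.
apply: (hx [set x | forall u v : Ahat n, Q (TA (u * x * v))]); split; last first.
  move=> _ [u [y [z [hu ->]]]] p q; rewrite mulrA.
  by apply: Aretract_swap; exact: deg_geMl.
split; first split; first split.
- move=> u v; rewrite mulr0 mul0r; apply: Aretract_deg_ge; exact: (subspace0 sF).
- move=> k y z /= hy hz u v; rewrite mulrDr mulrDl -scalerAr -scalerAl.
  apply: (subspaceB_in sQ (Aretract_linear _ _ _)); exact: sQ.2.
- by move=> p y /= hy; split=> u v; [rewrite mulrA | rewrite -!mulrA mulrA].
- move=> y hy u v; have [z hz yz] := hy N.
  rewrite -[y](subrK z) mulrDr mulrDl -[_ * (y - z) * v]scale1r.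
  apply: (subspaceB_in sQ (Aretract_linear _ _ _)); apply: sQ.2; last exact: hz.
  by apply: Aretract_deg_ge; apply: deg_geMr; exact: deg_geMl.
Qed.

(* What the elements of [L, L] satisfy modulo LLLL and degree N. The second
   clause, that [TA] turns right multiplication by e into a bracket with e, is
   what makes the property stable under brackets with L. *)
Definition derived_like x :=
  [/\ forall u v : Ahat n, deg_ge 1 u -> Q (TA (u * x * v)),
      forall v e : Ahat n, Lhat e -> Q (TA (x * v * e) - bracket (TA (x * v)) e)
    & Q (TA x - x)].

Lemma subspace_derived_like : subspace derived_like.
Proof.
have lin (T : Ahat n -> Ahat n) : Q (T 0) ->
    (forall k x y, Q (T (k *: x + y) - (k *: T x + T y))) -> subspace [set x | Q (T x)].
  move=> T0 hT; split=> // k x y /= hx hy; apply: (subspaceB_in sQ (hT k x y)).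
  exact: sQ.2.
have TA0 : Q (TA 0) by apply: Aretract_deg_ge; exact: (subspace0 sF).
have h1 (u v : Ahat n) : subspace [set x | Q (TA (u * x * v))].
  apply: lin => [|k x y]; first by rewrite mulr0 mul0r.
  by rewrite mulrDr mulrDl -scalerAr -scalerAl; exact: Aretract_linear.
have h2 (v e : Ahat n) : Lhat e ->
    subspace [set x | Q (TA (x * v * e) - bracket (TA (x * v)) e)].
  move=> he; apply: lin => [|k x y].
    rewrite !mul0r; apply: (subspaceB sQ) => //; exact: LLLL_deg_bracket.
  rewrite scalerBr addrACA -opprD; apply: (subspaceBB sQ).
    by rewrite !mulrDl -!scalerAl; exact: Aretract_linear.
  rewrite -bracketZl -bracketDl -bracketBl mulrDl -scalerAl.
  by apply: LLLL_deg_bracket => //; exact: Aretract_linear.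
have h3 : subspace [set x | Q (TA x - x)].
  apply: lin => [|k x y]; first by rewrite subr0.
  rewrite scalerBr addrACA -opprD; apply: (subspaceBB sQ).
    exact: Aretract_linear.
  by rewrite subrr; exact: (subspace0 sQ).
split.
- split=> [u v _|v e he|]; [exact: (h1 u v).1|exact: (h2 v e he).1|exact: h3.1].
- move=> k x y [x1 x2 x3] [y1 y2 y3]; split=> [u v hu|v e he|].
  + exact: (h1 u v).2 (x1 u v hu) (y1 u v hu).
  + exact: (h2 v e he).2 (x2 v e he) (y2 v e he).
  + exact: h3.2.
Qed.

Lemma derived_like_deg_ge x : deg_ge N x -> derived_like x.
Proof.
move=> hx; split=> [u v _|v e he|].
- by apply: Aretract_deg_ge; apply: deg_geMr; exact: deg_geMl.
- apply: (subspaceB sQ); first by apply: Aretract_deg_ge; do 2!apply: deg_geMr.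
  by apply: LLLL_deg_bracket => //; apply: Aretract_deg_ge; exact: deg_geMr.
- by apply: (subspaceB sQ); [exact: Aretract_deg_ge | exact: LLLL_deg_deg].
Qed.

(** In [x, e] v = x e v - e x v the last product is killed, because [e] has positive degree. So
    [x, e] may be replaced by x e in front of any [v], and the clauses for [x] give those for the
    bracket. *)
Lemma derived_like_bracket x e : derived_like x -> Lhat e -> derived_like (bracket x e).
Proof.
move=> [x1 x2 x3] he; have e1 := Lhat_deg_ge1 he.
have hz (v : Ahat n) : Q (TA (e * x * v)) by exact: x1.
have hb (v : Ahat n) : Q (TA (bracket x e * v) - TA (x * (e * v))).
  rewrite /bracket mulrBl -mulrA; apply: (subspaceBt sQ (AretractB _ _)).
  by rewrite addrAC subrr sub0r; apply: (subspaceN sQ).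
split=> [u v hu|v f hf|].
- rewrite /bracket mulrBr mulrBl; apply: (subspaceB_in sQ (AretractB _ _)).
  apply: (subspaceB sQ); last by rewrite mulrA; apply: x1; exact: deg_geMr.
  by rewrite mulrA -mulrA; exact: x1.
- rewrite -mulrA; apply: (subspaceBt sQ (hb _)); rewrite !mulrA.
  have := x2 (e * v) f hf; rewrite !mulrA => h; apply: (subspaceBt sQ h).
  rewrite -bracketBl; apply: LLLL_deg_bracket => //; apply: (subspaceBC sQ).
  by rewrite -mulrA; exact: hb.
- have := hb 1; rewrite !mulr1 => h; apply: (subspaceBt sQ h).
  have := x2 1 e he; rewrite !mulr1 => h'; apply: (subspaceBt sQ h').
  by rewrite -bracketBl; exact: LLLL_deg_bracket.
Qed.

Lemma linear_ncword c : linear_series (ncword [:: c]).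
Proof. by move=> w; rewrite /ncword; have [->|] := eqVneq w [:: c]. Qed.

Lemma derived_like_gen a b : derived_like (bracket (gen a) (gen b)).
Proof.
set z := bracket _ _; pose zs := bracket (ncword [:: a]) (ncword [:: b]).
have e0 : z = bracket (Api (ncword [:: a])) (Api (ncword [:: b])).
  by rewrite /z (genE a) (genE b).
have ez : z = Api zs by rewrite e0; exact/esym/Api_bracket.
have hz v : Q (TH (zs * ncword v) - adr z (rev v)).
  have := series_retract_bracket v (@linear_ncword a) (@linear_ncword b).
  by rewrite -/zs -e0.
have vV g : ncvalge N g -> Q (TH g).
  by move=> /series_retract_valge ->; exact: (subspace0 sQ).
split=> [u v hu|v e he|]; first exact: Aretract_swap.
  (* Membership in L is carried along because [LLLL_deg_bracket] needs it. *)
  suff h : @Lhat n `<=` [set e | Lhat e /\ forall v : Ahat n,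
      Q (TA (z * v * e) - bracket (TA (z * v)) e)].
    by have [_] := h e he; exact.
  apply: Lhat_ind => {v e he} [||i j hij].
  - split; first split.
    + split=> [|v]; first exact: (subspace0 sL).
      rewrite mulr0 bracketC (bracket0l (TA _)) oppr0 subr0.
      by apply: Aretract_deg_ge; exact: (subspace0 sF).
    + move=> k x y [hx Qx] [hy Qy]; split=> [|v]; first exact: sL.2.
      rewrite mulrDr -scalerAr; apply: (subspaceBt sQ (Aretract_linear _ _ _)).
      rewrite bracketDr bracketZr; apply: (subspaceBD sQ); last exact: Qy.
      by apply: (subspaceBZ sQ); exact: Qx.
    + move=> x y [hx Qx] [hy Qy]; split=> [|v]; first exact: Lhat_bracket.
      (* By Jacobi, the bracket with [x, y] is the difference of the two iterated brackets with x
         and y. Each of these comes from two uses of the hypotheses, the second with [v * p] in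
         place of [v]. *)
      have key p q : Lhat p -> Lhat q ->
          (forall v : Ahat n, Q (TA (z * v * p) - bracket (TA (z * v)) p)) ->
          (forall v : Ahat n, Q (TA (z * v * q) - bracket (TA (z * v)) q)) ->
          Q (TA (z * v * (p * q)) - bracket (bracket (TA (z * v)) p) q).
        move=> hp hq Qp Qq; rewrite mulrA -[z * v * p]mulrA.
        apply: (subspaceBt sQ (Qq (v * p))); rewrite mulrA -bracketBl.
        exact: LLLL_deg_bracket.
      rewrite -bracket_swap {1}/bracket mulrBr.
      apply: (subspaceBt sQ (AretractB _ _)).
      by apply: (subspaceBB sQ); exact: key.
  - move=> e he; split=> [|v].
      by apply: Lhat_fclosed => M; have [y [hy _] ey] := he M; exists y.
    have [y [hy Qy] ey] := he N; rewrite -[e](subrK y) mulrDr bracketDr.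
    rewrite -[_ * (e - y)]scale1r; apply: (subspaceBt sQ (Aretract_linear _ _ _)).
    rewrite scale1r; apply: (subspaceBD sQ); last exact: Qy.
    apply: (subspaceB sQ); first by apply: Aretract_deg_ge; exact: deg_geMl.
    apply: LLLL_deg_deg; rewrite bracketC; apply: (subspaceN sF).
    exact: deg_ge_bracketl.
  - split=> [|v]; first exact: Lhat_t.
    (* For a generator both sides are computed on words: the last letter of a word gives the
       outermost bracket in [adr]. *)
    have [c ->] := t_gen hij; rewrite -(ArepK v) ez.
    set g := Arep v; have -> : Api zs * Api g * gen c = Api (zs * g * ncword [:: c]).
      by rewrite (genE c) !rmorphM.
    rewrite -rmorphM; apply: (subspaceBt sQ (Aretract_Api _)).
    apply: (subspaceBC sQ); apply: (subspaceBt sQ (y := bracket (TH (zs * g)) (gen c))).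
      by rewrite -bracketBl; apply: LLLL_deg_bracket (Lhat_gen c) (Aretract_Api _).
    apply: (subspaceBC sQ).
    pose T g := TH (zs * g * ncword [:: c]) - bracket (TH (zs * g)) (gen c).
    rewrite -/(T g).
    apply: (@LLLL_deg_span T) => [k f1 f2|f1 hf1|w _]; rewrite /T.
    + rewrite mulrDr mulrDl -!scalerAr -scalerAl !series_retract_linear.
      by rewrite bracketDl bracketZl (scalerBr k (TH _)) opprD addrACA.
    + apply: (subspaceB sQ); first by apply: vV; apply: ncvalgeMr; exact: ncvalgeMl.
      by apply: LLLL_deg_bracket; [exact: Lhat_gen | apply: vV; exact: ncvalgeMl].
    + rewrite -mulrA ncwordM; apply: (subspaceBt sQ (hz _)).
      rewrite rev_cat /= -bracketBl; apply: LLLL_deg_bracket; first exact: Lhat_gen.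
      by apply: (subspaceBC sQ); exact: hz.
rewrite ez; apply: (subspaceBt sQ (Aretract_Api _)).
by have := hz [::]; rewrite ncword_nil mulr1 ez.
Qed.

Lemma linear_series_expand f : linear_series f -> f = \sum_c f [:: c] *: ncword [:: c].
Proof.
move=> hf; apply/funext => w; rewrite ncser_sum.
have [/eqP w1|w1] := boolP (size w == 1%N); last first.
  rewrite hf // big1 // => c _; rewrite ncserZ /ncword.
  by have [e|_] := eqVneq w [:: c]; [rewrite e in w1 | rewrite mulr0].
case: w w1 => [|a []] // _; rewrite (bigD1 a) //= big1 => [|c ca].
  by rewrite addr0 ncserZ /ncword eqxx mulr1.
by rewrite ncserZ /ncword eqseq_cons andbT eq_sym (negPf ca) mulr0.
Qed.

Lemma Api_linear_series f : linear_series f -> Api f = \sum_c f [:: c] *: gen c.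
Proof.
move=> /linear_series_expand {1}->; rewrite raddf_sum; apply: eq_bigr => c _.
by rewrite (genE c); exact: linearZ.
Qed.

Lemma Lhat_linear_series f : linear_series f -> Lhat (Api f).
Proof.
move=> /Api_linear_series ->; apply: (subspace_sum sL) => c _.
by apply: (subspaceZ sL); exact: Lhat_gen.
Qed.

Lemma derived_like_linear f g : linear_series f -> linear_series g ->
  derived_like (bracket (Api f) (Api g)).
Proof.
move=> /Api_linear_series -> /Api_linear_series ->.
have sD := subspace_derived_like.
rewrite bracket_suml; apply: (subspace_sum sD) => a _.
rewrite bracket_sumr; apply: (subspace_sum sD) => b _.
rewrite bracketZl bracketZr; do 2!apply: (subspaceZ sD).
exact: derived_like_gen.
Qed.

(** Splits off the linear part of a Lie element. A bracket has linear part 0, and expanding it along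
    the two splittings gives only derived-like terms. *)
Lemma Lhat_derived_like x : Lhat x ->
  exists2 f, linear_series f & derived_like (x - Api f).
Proof.
have sD := subspace_derived_like.
suff h : @Lhat n `<=` [set x | Lhat x /\
    exists2 f, linear_series f & derived_like (x - Api f)] by move=> /h[].
apply: Lhat_ind => {x} [||i j hij].
- split; first split.
  + split; first exact: (subspace0 sL).
    exists 0; first by move=> w.
    by rewrite raddf0 subr0; exact: (subspace0 sD).
  + move=> k x y [hx [f hf xf]] [hy [g hg yg]]; split; first exact: sL.2.
    exists (k *: f + g).
      by move=> w w1; rewrite ncserD ncserZ hf // hg // mulr0 addr0.
    by rewrite linearP opprD addrACA -scalerBr; exact: sD.2.
  + move=> x y [hx [f hf xf]] [hy [g hg yg]]; split; first exact: Lhat_bracket.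
    exists 0; first by move=> w.
    rewrite raddf0 subr0 -[x](subrK (Api f)) bracketDl; apply: (subspaceD sD).
      exact: derived_like_bracket.
    rewrite -[y](subrK (Api g)) bracketDr; apply: (subspaceD sD).
      rewrite bracketC; apply: (subspaceN sD).
      by apply: derived_like_bracket => //; exact: Lhat_linear_series.
    exact: derived_like_linear.
- move=> x hx; split.
    by apply: Lhat_fclosed => M; have [y [hy _] xy] := hx M; exists y.
  have [y [hy [f hf yf]] xy] := hx N; exists f => //.
  rewrite -(subrK y x) -addrA; apply: (subspaceD sD) => //.
  exact: derived_like_deg_ge.
- split; first exact: Lhat_t.
  by exists (tser n i j); [exact: linear_tser | rewrite subrr; exact: (subspace0 sD)].
Qed.

(** The linear part is a combination of letters, each fixed by [retract]; the rest is covered by the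
    third clause of [derived_like]. *)
Lemma Lhat_retract x : Lhat x -> Q (TA x - x).
Proof.
move=> /Lhat_derived_like[f hf [_ _ h]].
rewrite -{2}(subrK (Api f) x) -{1}(subrK (Api f) x) -[x - Api f]scale1r.
apply: (subspaceBt sQ (Aretract_linear _ _ _)); rewrite !scale1r.
apply: (subspaceBD sQ) => //; apply: (subspaceBt sQ (Aretract_Api _)).
apply: (@LLLL_deg_span (fun f => TH f - Api f)) => [k f1 f2|g hg|v hv].
- by rewrite series_retract_linear linearP opprD addrACA scalerBr.
- rewrite series_retract_valge // sub0r; apply: (subspaceN sQ).
  exact/LLLL_deg_deg/deg_ge_Api.
- have [c ev] := linear_series_word hf hv; rewrite ev -genE.
  exact: series_retract_word [:: c].
Qed.

End Metabelian.

(** Modulo [LLLL] and degree [N] the retraction sends [x] to 0, as an element of 1FF, and to [x], as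
    a Lie element. Since [N] is arbitrary and [LLLL] is closed, [x] lies in [LLLL]. *)
Lemma oneFF_Lhat_LLLL n (x : Ahat n) : oneFF x -> Lhat x -> LLLL x.
Proof.
move=> h1 hL; apply: LLLL_fclosed => N.
pose gen (c : chord n) := Api (ncword [:: c]).
have genE c : gen c = Api (ncword [:: c]) by [].
have sQ := subspace_LLLL_deg n N.
have := subspaceB sQ (oneFF_retract genE N h1) (Lhat_retract genE N hL).
by rewrite subKr => -[y hy xy]; exists y.
Qed.

(** * Reduction of the equations *)

Lemma oneFF_ideal n : two_sided_ideal (@oneFF n).
Proof.
split; first split.
- by move=> I [[[[]]]].
- move=> a x y hx hy I hI; have [[[_ h] _] _] := hI.1.
  by apply: h; [exact: hx | exact: hy].
- move=> a x hx; split=> I hI; have [[_ h] _] := hI.1.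
    by have [] := h a x (hx I hI).
  by have [] := h a x (hx I hI).
Qed.

Lemma oneFF_fclosed n : fclosed (@deg_ge n) (@oneFF n).
Proof.
move=> x hx I hI; apply: hI.1.2 => N.
by have [y hy xy] := hx N; exists y => //; exact: hy.
Qed.

Lemma oneFF_gen n (u x y : Ahat n) : deg_ge 1 u -> oneFF (u * bracket x y).
Proof. by move=> hu I hI; apply: hI.2; exists u, x, y. Qed.

Lemma LLLL_oneFF n (x : Ahat n) : LLLL x -> oneFF x.
Proof.
have hI := oneFF_ideal n; have sL := @subspace_Lhat n.
move=> hx; suff [] : Lhat x /\ oneFF x by [].
apply: (hx [set x | Lhat x /\ oneFF x]); split; last first.
  move=> _ [a [b [c [d [[ha hb hc hd] ->]]]]].
  have hab := Lhat_bracket ha hb; have hcd := Lhat_bracket hc hd.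
  split; first exact: Lhat_bracket.
  (* In [a, b][c, d] - [c, d][a, b] each product is an element of positive degree times a
     commutator. *)
  apply: (subspaceB hI.1); apply: oneFF_gen; exact: Lhat_deg_ge1.
split; first split.
- by move=> y [].
- split; first by split; [exact: (subspace0 sL) | exact: (subspace0 hI.1)].
  move=> k y z [hy fy] [hz fz]; split; first exact: sL.2.
  exact: hI.1.2.
- move=> l y hl [hy fy]; split; first exact: Lhat_bracket.
  by apply: (subspaceB hI.1); [exact: (hI.2 l y fy).1 | exact: (hI.2 l y fy).2].
move=> y hy; split.
  by apply: Lhat_fclosed => N; have [z [hz _] yz] := hy N; exists z.
by apply: oneFF_fclosed => N; have [z [_ hz] yz] := hy N; exists z.
Qed.

(** Congruence modulo 1FF passes between group-like elements and their logarithms, and for a Lie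
    element membership in 1FF is the same as membership in [LLLL]. *)
Lemma grouplike_eqmod n (x y : Ahat n) : grouplike x -> grouplike y ->
  eqmod (@oneFF n) x y <-> eqmod (@LLLL n) (logA x) (logA y).
Proof.
move=> [a ha ->] [b hb ->]; have a1 := Lhat_deg_ge1 ha; have b1 := Lhat_deg_ge1 hb.
have hI := oneFF_ideal n; have cI := @oneFF_fclosed n.
rewrite /eqmod; split=> [h|]; rewrite !logA_expA //; last first.
  by move=> /LLLL_oneFF; exact: (power_sum_ideal _ hI cI a1 b1).
apply: oneFF_Lhat_LLLL; last exact: (subspaceB (@subspace_Lhat n) ha hb).
rewrite -[a]logA_expA // -[b]logA_expA //.
rewrite /logA; apply: (power_sum_ideal _ hI cI);
  [exact: expA_sub1 a1 | exact: expA_sub1 b1 |].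
by rewrite opprB addrA subrK.
Qed.

(** Two strands are too few for any defining relation, so there is none to check. *)
Lemma grouplike_alg_map2 m F (x : Ahat 2) :
  Lhat (F 1%N 2%N) -> grouplike x -> @grouplike m (alg_map F x).
Proof.
move=> hF; have gF i j : strands 2 [:: i; j] -> sym_gen F i j = F 1%N 2%N.
  by move=> /strands2P[]; move: i j => [|[|[|i]]] [|[|[|j]]].
have hL i j : strands 2 [:: i; j] -> Lhat (sym_gen F i j) by move=> /gF ->.
apply: alg_map_grouplike => //.
- by move=> i j /hL /Lhat_deg_ge1.
- by move=> i j k /strands_size.
- by move=> i j k l /strands_size.
Qed.

(** The relation on strands i, j, k is symmetric in i and k, so one relation for each choice of the
    middle strand j suffices; the commutation relation would need four strands. *)
Lemma grouplike_alg_map3 m F (x : Ahat 3) :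
  Lhat (F 1%N 2%N) -> Lhat (F 1%N 3%N) -> Lhat (F 2%N 3%N) ->
  bracket (F 1%N 2%N + F 2%N 3%N) (F 1%N 3%N) = 0 ->
  bracket (F 1%N 2%N + F 1%N 3%N) (F 2%N 3%N) = 0 ->
  bracket (F 1%N 3%N + F 2%N 3%N) (F 1%N 2%N) = 0 ->
  grouplike x -> @grouplike m (alg_map F x).
Proof.
move=> h12 h13 h23 b1 b2 b3.
have hL i j : strands 3 [:: i; j] -> Lhat (sym_gen F i j).
  by move=> /strands2P[]; move: i j => [|[|[|[|i]]]] [|[|[|[|j]]]].
apply: alg_map_grouplike => //.
- by move=> i j /hL /Lhat_deg_ge1.
- move=> i j k; rewrite /strands /= !inE negb_or andbT.
  move=> /and4P[/andP[/andP[ij ik] jk] i0 j0 /andP[k0 _]].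
  move: ij ik jk i0 j0 k0.
  by move: i j k => [|[|[|[|i]]]] [|[|[|[|j]]]] [|[|[|[|k]]]] // *;
     rewrite /sym_gen /= // addrC.
- by move=> i j k l /strands_size.
Qed.

(** * Relations under relabelling and strand doubling *)

Lemma bracket_tt n i j k : strands n [:: i; j; k] ->
  bracket (t i j + t j k) (t i k) = 0 :> Ahat n.
Proof.
move=> hs; rewrite /t -raddfD -Api_bracket -(raddf0 (@Api n)).
apply/Api_eq; rewrite subr0; apply: relset_relator; left.
by exists i, j, k.
Qed.

Lemma bracket_tt_disjoint n i j k l : strands n [:: i; j; k; l] ->
  bracket (t i j) (t k l) = 0 :> Ahat n.
Proof.
move=> hs; rewrite /t -Api_bracket -(raddf0 (@Api n)).
apply/Api_eq; rewrite subr0; apply: relset_relator; right.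
by exists i, j, k, l.
Qed.

Lemma bracket_tt' n i j k : strands n [:: i; j; k] ->
  bracket (t i j + t k j) (t i k) = 0 :> Ahat n.
Proof. by rewrite (tC n k j); exact: bracket_tt. Qed.

Lemma bracket_tt'' n i j k : strands n [:: i; j; k] ->
  bracket (t j i + t j k) (t i k) = 0 :> Ahat n.
Proof. by rewrite (tC n j i); exact: bracket_tt. Qed.

Lemma grouplike_relabel2 m i j x : strands m [:: i; j] ->
  grouplike x -> grouplike (@relabel 2 m [:: i; j] x).
Proof. by move=> hs; apply: grouplike_alg_map2; exact: Lhat_t. Qed.

Lemma grouplike_relabel3 m i j k x : strands m [:: i; j; k] ->
  grouplike x -> grouplike (@relabel 3 m [:: i; j; k] x).
Proof.
move=> hs; move: (hs); rewrite /strands /= !inE negb_or andbT.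
move=> /and4P[/andP[/andP[ij ik] jk] hi hj /andP[hk _]].
have [hij' hjk' hik'] := strands3P hs.
apply: grouplike_alg_map3 => /=; [exact: Lhat_t | exact: Lhat_t | exact: Lhat_t |  |  |].
- exact: bracket_tt.
- apply: bracket_tt''.
  by rewrite /strands /= !inE negb_or eq_sym ij jk ik hi hj hk.
- apply: bracket_tt'.
  by rewrite /strands /= !inE negb_or ij ik [k == j]eq_sym jk hi hj hk.
Qed.

Section DoublingRelations.
Variable A : algType rat.
Implicit Types x y : A.

(** The case of a doubled middle strand: the sum of the relations for its two copies. *)
Lemma bracket_sum22 x1 x2 x3 x4 y :
  bracket (x1 + x3) y = 0 -> bracket (x2 + x4) y = 0 ->
  bracket (x1 + x2 + (x3 + x4)) y = 0.
Proof. by move=> h1 h2; rewrite addrACA bracketDl h1 h2 addr0. Qed.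

(** The case of a doubled outer strand: [x1], [x2] join its copies to the middle strand, [y1], [y2]
    join them to the other outer strand, and [x3] joins these two strands. Each copy satisfies its
    relation, and the cross terms are brackets of disjoint chords. *)
Lemma bracket_sum3 x1 x2 x3 y1 y2 :
  bracket (x1 + x3) y1 = 0 -> bracket x2 y1 = 0 ->
  bracket (x2 + x3) y2 = 0 -> bracket x1 y2 = 0 ->
  bracket (x1 + x2 + x3) (y1 + y2) = 0.
Proof.
move=> h1 h2 h3 h4; rewrite bracketDr -[in X in _ + X]addrA.
by rewrite (addrAC x1) (bracketDl (x1 + x3)) h1 h2 (bracketDl x1) h3 h4 !addr0.
Qed.

End DoublingRelations.

Lemma Lhat_tD n i j k l : strands n [:: i; j] -> strands n [:: k; l] ->
  Lhat (t i j + t k l : Ahat n).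
Proof. by move=> h1 h2; apply: (subspaceD (@subspace_Lhat n)); exact: Lhat_t. Qed.

Lemma grouplike_D1 x : grouplike x -> grouplike (D1 x).
Proof. by apply: grouplike_alg_map2; exact: Lhat_tD. Qed.

Lemma grouplike_D11 x : grouplike x -> grouplike (D11 x).
Proof.
apply: grouplike_alg_map3 => /=; rewrite /on3 /=.
- exact: Lhat_tD.
- exact: Lhat_tD.
- exact: Lhat_t.
- apply: bracket_sum3.
  + exact: (@bracket_tt 4 1 3 4).
  + exact: (@bracket_tt_disjoint 4 2 3 1 4).
  + exact: (@bracket_tt 4 2 3 4).
  + exact: (@bracket_tt_disjoint 4 1 3 2 4).
- apply: bracket_sum22.
  + exact: (@bracket_tt'' 4 3 1 4).
  + exact: (@bracket_tt'' 4 3 2 4).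
- apply: bracket_sum3.
  + exact: (@bracket_tt' 4 1 4 3).
  + exact: (@bracket_tt_disjoint 4 2 4 1 3).
  + exact: (@bracket_tt' 4 2 4 3).
  + exact: (@bracket_tt_disjoint 4 1 4 2 3).
Qed.

Lemma grouplike_oneD1 x : grouplike x -> grouplike (oneD1 x).
Proof.
apply: grouplike_alg_map3 => /=; rewrite /on3 /=.
- exact: Lhat_tD.
- exact: Lhat_t.
- exact: Lhat_tD.
- apply: bracket_sum22.
  + exact: (@bracket_tt 4 1 2 4).
  + exact: (@bracket_tt 4 1 3 4).
- apply: bracket_sum3.
  + exact: (@bracket_tt'' 4 2 1 4).
  + exact: (@bracket_tt_disjoint 4 1 3 2 4).
  + exact: (@bracket_tt'' 4 3 1 4).
  + exact: (@bracket_tt_disjoint 4 1 2 3 4).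
- rewrite addrC; apply: bracket_sum3.
  + rewrite addrC; exact: (@bracket_tt' 4 1 4 2).
  + exact: (@bracket_tt_disjoint 4 3 4 1 2).
  + rewrite addrC; exact: (@bracket_tt' 4 1 4 3).
  + exact: (@bracket_tt_disjoint 4 2 4 1 3).
Qed.

Lemma grouplike_oneoneD x : grouplike x -> grouplike (oneoneD x).
Proof.
apply: grouplike_alg_map3 => /=; rewrite /on3 /=.
- exact: Lhat_t.
- exact: Lhat_tD.
- exact: Lhat_tD.
- rewrite addrC; apply: bracket_sum3.
  + rewrite addrC; exact: (@bracket_tt 4 1 2 3).
  + exact: (@bracket_tt_disjoint 4 2 4 1 3).
  + rewrite addrC; exact: (@bracket_tt 4 1 2 4).
  + exact: (@bracket_tt_disjoint 4 2 3 1 4).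
- rewrite addrC; apply: bracket_sum3.
  + rewrite addrC; exact: (@bracket_tt'' 4 2 1 3).
  + exact: (@bracket_tt_disjoint 4 1 4 2 3).
  + rewrite addrC; exact: (@bracket_tt'' 4 2 1 4).
  + exact: (@bracket_tt_disjoint 4 1 3 2 4).
- apply: bracket_sum22.
  + exact: (@bracket_tt' 4 1 3 2).
  + exact: (@bracket_tt' 4 1 4 2).
Qed.

Lemma grouplikeV n (x : Ahat n) : grouplike x -> grouplike x^-1.
Proof.
move=> [a ha ->]; exists (- a); first exact: (subspaceN (@subspace_Lhat n) ha).
by rewrite expAV //; exact: Lhat_deg_ge1.
Qed.

Lemma grouplike_hexagon_rhs Phi R : grouplike Phi -> grouplike R ->
  grouplike (hexagon_rhs Phi R).
Proof.
move=> hPhi hR; have hPhiV := grouplikeV hPhi.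
by do ![apply: grouplikeM]; do ?[exact: grouplike_relabel2 | exact: grouplike_relabel3].
Qed.

Theorem theorem2 (R : Ahat 2) (Phi : Ahat 3) :
  R = expA (t 1 2) ->
  Phi * relabel 3 [:: 3; 2; 1]%N Phi = 1 ->
  eta 1 Phi = 1 -> eta 2 Phi = 1 -> eta 3 Phi = 1 ->
  (exists2 phi, Lhat phi & Phi = expA phi) ->
  [/\ grouplike (hexagon_lhs R) /\ grouplike (hexagon_rhs Phi R),
      grouplike (hexagon_lhs R^-1) /\ grouplike (hexagon_rhs Phi R^-1),
      grouplike (pentagon_lhs Phi) /\ grouplike (pentagon_rhs Phi) &
      [/\ eqmod (@oneFF 3) (hexagon_lhs R) (hexagon_rhs Phi R) <->
          eqmod (@LLLL 3) (logA (hexagon_lhs R)) (logA (hexagon_rhs Phi R)),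
          eqmod (@oneFF 3) (hexagon_lhs R^-1) (hexagon_rhs Phi R^-1) <->
          eqmod (@LLLL 3) (logA (hexagon_lhs R^-1))
                          (logA (hexagon_rhs Phi R^-1)) &
          eqmod (@oneFF 4) (pentagon_lhs Phi) (pentagon_rhs Phi) <->
          eqmod (@LLLL 4) (logA (pentagon_lhs Phi))
                          (logA (pentagon_rhs Phi))]].
Proof.
move=> eR _ _ _ _ hPhi.
have hR : grouplike R by exists (t 1 2); [exact: Lhat_t | exact: eR].
have hRV := grouplikeV hR.
have hexl := grouplike_D1 hR; have hexlV := grouplike_D1 hRV.
have hexr := grouplike_hexagon_rhs hPhi hR.
have hexrV := grouplike_hexagon_rhs hPhi hRV.
have penl : grouplike (pentagon_lhs Phi).
  apply: grouplikeM; last exact: grouplike_relabel3.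
  apply: grouplikeM; [exact: grouplike_relabel3 | exact: grouplike_oneD1].
have penr : grouplike (pentagon_rhs Phi).
  by apply: grouplikeM; [exact: grouplike_D11 | exact: grouplike_oneoneD].
by split; [| | | split; exact: grouplike_eqmod].
Qed.
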